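(* Let $p$ be a prime. For each $\alpha\ge\log p$, $$L_p(\alpha)=\frac{\log(p-1)+\log(\alpha-\log p)-\log\log p+\alpha\log_p\alpha-\alpha\log_p(\alpha-\log p)}{\alpha},$$ where for $\alpha=\log p$ the right-hand side is interpreted as its limit as $\alpha\downarrow\log p$, namely $\frac{\log(p-1)}{\log p}$.
   Context: $\log$ is the natural logarithm and $\log_p x=\log x/\log p$. $\mathbb{Q}_p$ is the field of $p$-adic numbers with valuation $v_p$ and absolute value $|x|_p=p^{-v_p(x)}$, and $p\mathbb{Z}_p=\{x\in\mathbb{Q}_p:|x|_p<1\}$. The Schneider map $T_p:p\mathbb{Z}_p\to p\mathbb{Z}_p$ is $T_p(0)=0$ and, for $x\ne0$, $T_p(x)=\frac{p^{a_1(x)}}{x}-b_1(x)$, where $a_1(x)=v_p(x)$ and $b_1(x)\in\{1,\dots,p-1\}$ is determined by $b_1(x)\equiv p^{a_1(x)}/x \pmod p$. Let $F=\bigcup_{k\ge0}T_p^{-k}(0)$, and for $x\in p\mathbb{Z}_p\setminus F$, $i\ge1$, let $a_i(x)=a_1(T_p^{i-1}x)$. Define $\psi(x)=p^{a_1(x)}$, and for $x\in p\mathbb{Z}_p\setminus F$ the Lyapunov exponent $\lambda_p(x)=\lim_{n\to\infty}\frac1n\sum_{k=0}^{n-1}\log\psi(T_p^kx)=\lim_{n\to\infty}\log p\cdot\frac{a_1(x)+\cdots+a_n(x)}{n}$ whenever this limit exists. Let $J_p(\alpha)=\{x\in p\mathbb{Z}_p\setminus F:\lambda_p(x)=\alpha\}$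 and $L_p(\alpha)=\dim_{\mathrm H}J_p(\alpha)$, the Hausdorff dimension with respect to the $p$-adic metric. *)

(* Defs.v *)
From HB Require Import structures.
From mathcomp Require Import all_boot all_order all_algebra.
From mathcomp Require Import all_classical all_reals all_analysis.
Set Implicit Arguments.
Unset Strict Implicit.
Unset Printing Implicit Defensive.
Import Order.TTheory GRing.Theory Num.Theory.
Import numFieldNormedType.Exports.
Local Open Scope classical_set_scope.
Local Open Scope ring_scope.

(* The ring of p-adic integers as the inverse limit of the rings Z / p^n:
   [x n] is the representative of x modulo p^n in {0, ..., p^n - 1}; the
   compatibility condition forces x n < p^n, and in particular x 0 = 0. *)
Record padic_int (p : nat) (p_pr : prime p) := PadicInt {
  padic_digits :> nat -> nat;
  padic_intP : forall n, padic_digits n = (padic_digits n.+1 %% p ^ n)%N }.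

HB.instance Definition _ (p : nat) (p_pr : prime p) :=
  gen_eqMixin (padic_int p_pr).
HB.instance Definition _ (p : nat) (p_pr : prime p) :=
  gen_choiceMixin (padic_int p_pr).

Section PadicIntRing.
Variables (p : nat) (p_pr : prime p).
Implicit Types x y z : padic_int p_pr.

Lemma padic_int_eq x y : (forall n, x n = y n) -> x = y.
Proof.
case: x y => [f fP] [g gP] /= fg; have efg : f = g by apply/funext.
by subst g; congr PadicInt; apply: Prop_irrelevance.
Qed.

Lemma padic_int_mod x m n : (m <= n)%N -> x m = (x n %% p ^ m)%N.
Proof.
elim: n => [|n IHn].
  by rewrite leqn0 => /eqP ->; rewrite (padic_intP x 0) modn_mod.
rewrite leq_eqVlt => /orP[/eqP ->|].
  by rewrite (padic_intP x n.+1) modn_mod.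
rewrite ltnS => mn; rewrite IHn // (padic_intP x n) modn_dvdm //.
exact: dvdn_exp2l.
Qed.

(* The element of Z_p given by any p-adically compatible sequence. *)
Definition padic_lim (f : nat -> nat)
    (fP : forall n, (f n = f n.+1 %[mod p ^ n])%N) : padic_int p_pr.
Proof.
exists (fun n => f n %% p ^ n)%N => n.
by rewrite [RHS]modn_dvdm ?dvdn_exp2l // fP.
Defined.

Lemma padic_nat_compat (a n : nat) : (a = a %[mod p ^ n])%N.
Proof. by []. Qed.

Definition padic_of_nat (a : nat) := padic_lim (padic_nat_compat a).

Lemma padic_add_compat x y n : (x n + y n = x n.+1 + y n.+1 %[mod p ^ n])%N.
Proof.
by rewrite (padic_intP x n) (padic_intP y n) modnDml modnDmr.
Qed.

Definition padic_add x y := padic_lim (padic_add_compat x y).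

Lemma padic_mul_compat x y n : (x n * y n = x n.+1 * y n.+1 %[mod p ^ n])%N.
Proof.
by rewrite (padic_intP x n) (padic_intP y n) modnMml modnMmr.
Qed.

Definition padic_mul x y := padic_lim (padic_mul_compat x y).

(* (p^n - 1) * x n represents - x modulo p^n. *)
Lemma padic_opp_compat x n :
  ((p ^ n).-1 * x n = (p ^ n.+1).-1 * x n.+1 %[mod p ^ n])%N.
Proof.
have pos m : (0 < p ^ m)%N by rewrite expn_gt0 prime_gt0.
apply/eqP; rewrite (padic_intP x n) modnMmr -(eqn_modDr (x n.+1)).
by rewrite -!mulSnr !prednK // expnS -mulnA mulnCA !modnMr.
Qed.

Definition padic_opp x := padic_lim (padic_opp_compat x).

Lemma padic_addA : associative padic_add.
Proof.
by move=> x y z; apply: padic_int_eq => n /=; rewrite modnDmr modnDml addnA.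
Qed.

Lemma padic_addC : commutative padic_add.
Proof. by move=> x y; apply: padic_int_eq => n /=; rewrite addnC. Qed.

Lemma padic_digit_mod x n : (x n %% p ^ n = x n)%N.
Proof. by rewrite {1}(padic_intP x n) modn_mod -padic_intP. Qed.

Lemma padic_add0 : left_id (padic_of_nat 0) padic_add.
Proof.
by move=> x; apply: padic_int_eq => n /=; rewrite modnDml padic_digit_mod.
Qed.

Lemma padic_addN : left_inverse (padic_of_nat 0) padic_opp padic_add.
Proof.
move=> x; apply: padic_int_eq => n /=; rewrite modnDml -mulSnr prednK.
  by rewrite modnMr mod0n.
by rewrite expn_gt0 prime_gt0.
Qed.

HB.instance Definition _ := GRing.isZmodule.Build (padic_int p_pr)
  padic_addA padic_addC padic_add0 padic_addN.

Lemma padic_mulA : associative padic_mul.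
Proof.
by move=> x y z; apply: padic_int_eq => n /=; rewrite modnMmr modnMml mulnA.
Qed.

Lemma padic_mulC : commutative padic_mul.
Proof. by move=> x y; apply: padic_int_eq => n /=; rewrite mulnC. Qed.

Lemma padic_mul1 : left_id (padic_of_nat 1) padic_mul.
Proof.
move=> x; apply: padic_int_eq => n /=.
by rewrite modnMml mul1n padic_digit_mod.
Qed.

Lemma padic_mulDl : left_distributive padic_mul padic_add.
Proof.
move=> x y z; apply: padic_int_eq => n /=.
by rewrite modnMml modnDml modnDmr mulnDl.
Qed.

Lemma padic_1neq0 : padic_of_nat 1 != 0.
Proof.
apply/eqP => /(congr1 (fun x : padic_int p_pr => x 1%N)) /=.
by rewrite expn1 mod0n modn_small // prime_gt1.
Qed.

HB.instance Definition _ := GRing.Zmodule_isComNzRing.Build (padic_int p_pr)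
  padic_mulA padic_mulC padic_mul1 padic_mulDl padic_1neq0.

Definition padic_int_unit : pred (padic_int p_pr) :=
  fun x => `[< exists y, y * x = 1 >].

Definition padic_int_inv x : padic_int p_pr :=
  xget x [set y : padic_int p_pr | y * x = 1].

Lemma padic_int_mulV :
  {in padic_int_unit, left_inverse 1 padic_int_inv *%R}.
Proof. by move=> x /asboolP[y yx]; rewrite /padic_int_inv; case: xgetP => [z _ //|/(_ y)]. Qed.

Lemma padic_int_unitP x y : y * x = 1 -> padic_int_unit x.
Proof. by move=> yx; apply/asboolP; exists y. Qed.

Lemma padic_int_inv_out :
  {in [predC padic_int_unit], padic_int_inv =1 id}.
Proof.
move=> x /negP xU; rewrite /padic_int_inv; case: xgetP => // y _ yx.
by case: xU; apply: padic_int_unitP yx.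
Qed.

HB.instance Definition _ := GRing.ComNzRing_hasMulInverse.Build
  (padic_int p_pr) padic_int_mulV padic_int_unitP padic_int_inv_out.

Lemma padic_int_neq0 x : x != 0 -> exists n, x n != 0%N.
Proof.
move=> /eqP x0; apply: contrapT => /forallNP x0'; apply: x0.
by apply: padic_int_eq => n /=; rewrite mod0n; have /negP/negbNE/eqP := x0' n.
Qed.

Lemma padic_int_idomain x y : x * y = 0 -> (x == 0) || (y == 0).
Proof.
move=> xy0; apply/norP => -[/padic_int_neq0[m xm] /padic_int_neq0[n yn]].
have := congr1 (fun z : padic_int p_pr => z (m + n)%N) xy0.
rewrite /= mod0n => /eqP; apply/negP.
move: xm yn; rewrite (padic_int_mod x (leq_addr n m)).
rewrite (padic_int_mod y (leq_addl m n)) => xm yn.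
have pos (z k : nat) : (z %% p ^ k != 0 -> 0 < z)%N.
  by case: z => //; rewrite mod0n.
have lt (z k : nat) : (z %% p ^ k != 0 -> logn p z < k)%N.
  by move=> zk; rewrite ltnNge -pfactor_dvdn // (pos _ _ zk).
rewrite -/(dvdn _ _) pfactor_dvdn ?muln_gt0 ?(pos _ _ xm) ?(pos _ _ yn) //.
rewrite lognM ?(pos _ _ xm) ?(pos _ _ yn) // -ltnNge.
by rewrite -addSn leq_add ?lt // ltnW // lt.
Qed.

HB.instance Definition _ := GRing.ComUnitRing_isIntegral.Build
  (padic_int p_pr) padic_int_idomain.

Lemma padic_natrE (a n : nat) : (a%:R : padic_int p_pr) n = (a %% p ^ n)%N.
Proof.
elim: a => [|a IHa] //.
by rewrite -natr1 [LHS]/= IHa modnDml modnDmr addn1.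
Qed.

Lemma padic_int_unitE x : (x \is a GRing.unit) = (x 1%N != 0%N).
Proof.
apply/idP/idP => [/mulVr|x1].
  move=> /(congr1 (fun z : padic_int p_pr => z 1%N)) /=.
  rewrite expn1 [RHS]modn_small ?prime_gt1 // => E; apply/eqP => x1.
  by move: E; rewrite x1 muln0 mod0n.
have x_coprime n : coprime (x n) (p ^ n).
  case: n => [|n]; first by rewrite coprimen1.
  rewrite coprime_sym coprimeXl // prime_coprime //; apply: contra x1.
  by rewrite (padic_int_mod x (ltn0Sn n)) expn1.
pose f n := (egcdn (x n) (p ^ n)).1.
have fP n : (f n * x n = 1 %[mod p ^ n])%N.
  have [|x0] := posnP (x n).
    move=> E; have := x_coprime n; rewrite E /coprime gcd0n => /eqP ->.
    by rewrite !modn1.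
  rewrite /f; case: egcdnP => //= u v -> _.
  by rewrite (eqP (x_coprime n)) modnMDl.
have fc n : (f n = f n.+1 %[mod p ^ n])%N.
  have /(congr1 (modn^~ (p ^ n)%N)) := fP n.+1.
  rewrite !modn_dvdm ?dvdn_exp2l // -(modnMmr _ (x n.+1)) -padic_intP => E.
  rewrite -[f n in LHS]muln1 -modnMmr -E modnMmr mulnCA -modnMmr fP modnMmr.
  by rewrite muln1.
apply/unitrP; exists (padic_lim fc).
suff fx : padic_lim fc * x = 1 by rewrite [x * _]mulrC.
by apply: padic_int_eq => n /=; rewrite modnMml fP.
Qed.

Lemma padic_int_divp x n : x n = 0%N -> exists y, x = p%:R ^+ n * y.
Proof.
move=> xn0.
have dv m : (p ^ n %| x (n + m))%N.
  by rewrite /dvdn -(padic_int_mod x (leq_addr m n)) xn0.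
pose f m := (x (n + m) %/ p ^ n)%N.
have pos k : (0 < p ^ k)%N by rewrite expn_gt0 prime_gt0.
have fc m : (f m = f m.+1 %[mod p ^ m])%N.
  apply/eqP; rewrite -(eqn_pmul2l (pos n)) !muln_modr -!expnD.
  rewrite ![(p ^ n * f _)%N]mulnC !divnK // addnS.
  by rewrite -padic_intP padic_digit_mod.
exists (padic_lim fc); apply: padic_int_eq => m.
rewrite -natrX [RHS]/= padic_natrE modnMml modnMmr mulnC divnK //.
by rewrite -padic_int_mod ?leq_addl.
Qed.

Lemma padic_int_decomp x : x != 0 ->
  exists n u, u \is a GRing.unit /\ x = p%:R ^+ n * u.
Proof.
move=> /padic_int_neq0 xN0; case: (ex_minnP xN0) => -[|n] xn nmin.
  by move: xn; rewrite (padic_intP x 0) modn1.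
have xn0 : x n = 0%N.
  by apply/eqP; apply: contraTT (leqnn n.+1) => /nmin; rewrite -!ltnNge.
have [u xE] := padic_int_divp xn0; exists n, u; split => //.
rewrite padic_int_unitE; apply: contra xn => /eqP u0; rewrite xE.
have [w ->] := padic_int_divp u0.
rewrite mulrA -exprD addn1 -natrX /= padic_natrE modnn mul0n mod0n.
by [].
Qed.

End PadicIntRing.

(* The field Q_p, as the fraction field of Z_p. The parameter R is the field of
   real numbers in which the p-adic absolute value takes its values: it does
   not enter the carrier, but makes it a metric space over R. *)
Definition padic (R : realType) (p : nat) (p_pr : prime p) : Type :=
  {fraction padic_int p_pr}.

HB.instance Definition _ (R : realType) (p : nat) (p_pr : prime p) :=
  GRing.Field.on (padic R p_pr).

Section Padic.
Variables (R : realType) (p : nat) (p_pr : prime p).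
Local Notation Zp := (padic_int p_pr).
Local Notation Qp := (padic R p_pr).
Implicit Types (x y z : Qp) (u w : Zp).

Definition padic_inj (u : Zp) : Qp := FracField.tofrac u.

HB.instance Definition _ := GRing.RMorphism.copy padic_inj (@FracField.tofrac Zp).

(* v_p(x) is the integer k such that x = p^k u with u a unit of Z_p;
   it is set to 0 at x = 0. *)
Definition padic_val (x : Qp) : int :=
  xget 0 [set k : int |
    exists2 u : Zp, u \is a GRing.unit & x = p%:R ^ k * padic_inj u].

Definition padic_abs (x : Qp) : R :=
  if x == 0 then 0 else p%:R ^ (- padic_val x).

Lemma padic_inj_eq0 u : (padic_inj u == 0) = (u == 0).
Proof. exact: tofrac_eq0. Qed.

Lemma padic_p_neq0 : p%:R != 0 :> Qp.
Proof.
rewrite -(rmorph_nat padic_inj) padic_inj_eq0; apply/eqP.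
move=> /(congr1 (fun z : Zp => z 2)); rewrite padic_natrE /= mod0n.
rewrite modn_small; last by rewrite -{1}(expn1 p) ltn_exp2l ?prime_gt1.
by move=> p0; have := prime_gt0 p_pr; rewrite p0.
Qed.

Lemma padic_p_int_unit : (p%:R : Zp) \isn't a GRing.unit.
Proof. by rewrite padic_int_unitE padic_natrE expn1 modnn. Qed.

Lemma padic_decomp x : x != 0 ->
  exists (k : int) u, u \is a GRing.unit /\ x = p%:R ^ k * padic_inj u.
Proof.
have p0 := padic_p_neq0.
have pn : p%:R = padic_inj p%:R by rewrite rmorph_nat.
have [a [b [b0 ->]]] : exists a b, b != 0 /\ x = padic_inj a / padic_inj b.
  elim/quotW: x => r; exists (frac r).1, (frac r).2; split.
    exact: denom_ratioP.
  rewrite /padic_inj; unlock FracField.tofrac.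
  rewrite -[_^-1]FracField.pi_inv -[_ * _]FracField.pi_mul.
  rewrite /FracField.mulf /FracField.invf !numden_Ratio ?oner_neq0 //;
    try exact: denom_ratioP.
  by rewrite mulr1 mul1r Ratio_numden.
rewrite mulf_eq0 padic_inj_eq0 => /norP[a0 _].
have [m [u [uU ->]]] := padic_int_decomp a0.
have [n [w [wU ->]]] := padic_int_decomp b0.
exists (m%:Z - n%:Z), (u / w); split; first by rewrite unitrM unitrV uU.
rewrite expfzDr // -exprnN !rmorphM !rmorphXn /= rmorphV //= -pn invfM.
by rewrite mulrACA.
Qed.

Lemma padic_val_unique k l u w : u \is a GRing.unit -> w \is a GRing.unit ->
  p%:R ^ k * padic_inj u = p%:R ^ l * padic_inj w -> k = l.
Proof.
have p0 := padic_p_neq0.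
wlog lt_kl : k l u w / k < l => [hw uU wU E|uU wU E].
  have [kl|lk|//] := ltgtP k l; first exact: (hw k l u w).
  by apply/esym/(hw l k w u).
case/negP: padic_p_int_unit.
have [n nE] : exists n : nat, l - k = n.+1%:Z.
  have : 0 < l - k by rewrite subr_gt0.
  by case: (l - k) => [[|n]|n] // _; exists n.
have : padic_inj u = padic_inj (p%:R ^+ n.+1 * w).
  rewrite rmorphM rmorphXn rmorph_nat exprnP -nE.
  apply: (@mulfI _ (p%:R ^ k)); first exact: expfz_neq0.
  by rewrite E mulrA -expfzDr // addrC subrK.
move/eqP; rewrite tofrac_eq => /eqP uE.
by move: uU; rewrite uE exprS -mulrA unitrM => /andP[].
Qed.

Lemma padic_valE k u : u \is a GRing.unit ->
  padic_val (p%:R ^ k * padic_inj u) = k.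
Proof.
move=> uU; rewrite /padic_val; case: xgetP => [l _ [w wU]|/(_ k)].
  by move/padic_val_unique => /(_ uU wU).
by case; exists u.
Qed.

Lemma padic_val_decomp x : x != 0 ->
  exists2 u, u \is a GRing.unit & x = p%:R ^ padic_val x * padic_inj u.
Proof.
by move=> /padic_decomp[k [u [uU ->]]]; exists u; rewrite ?padic_valE.
Qed.

Lemma padic_abs_inj u : padic_abs (padic_inj u) <= 1.
Proof.
rewrite /padic_abs padic_inj_eq0; case: eqVneq => [//|u0].
have [n [w [wU ->]]] := padic_int_decomp u0.
rewrite rmorphM rmorphXn rmorph_nat exprnP padic_valE // -exprnN invf_le1.
  by rewrite -natrX ler1n expn_gt0 prime_gt0.
by rewrite exprn_gt0 // ltr0n prime_gt0.
Qed.

Lemma padic_absM x y : padic_abs (x * y) = padic_abs x * padic_abs y.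
Proof.
rewrite /padic_abs mulf_eq0.
have [|x0] := eqVneq x 0; first by rewrite mul0r.
have [|y0] := eqVneq y 0; first by rewrite mulr0.
have [u uU xE] := padic_val_decomp x0; have [w wU yE] := padic_val_decomp y0.
rewrite {1}xE {1}yE mulrACA -expfzDr ?padic_p_neq0 // -rmorphM padic_valE.
  by rewrite opprD expfzDr // pnatr_eq0 -lt0n prime_gt0.
by rewrite unitrM uU.
Qed.

Lemma padic_absN x : padic_abs (- x) = padic_abs x.
Proof.
rewrite /padic_abs oppr_eq0; have [//|x0] := eqVneq x 0.
have [u uU xE] := padic_val_decomp x0.
by rewrite {1}xE -mulrN -rmorphN padic_valE // unitrN.
Qed.

Lemma padic_abs_ge0 x : 0 <= padic_abs x.
Proof. by rewrite /padic_abs; case: ifP => // _; rewrite exprz_ge0. Qed.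

Lemma padic_abs_eq0 x : padic_abs x = 0 -> x = 0.
Proof.
rewrite /padic_abs; case: eqP => // _ /eqP.
by rewrite expfz_eq0 pnatr_eq0 (gtn_eqF (prime_gt0 p_pr)) andbF.
Qed.

Lemma padic_abs_ultra x y :
  padic_abs (x + y) <= Num.max (padic_abs x) (padic_abs y).
Proof.
have p0 := padic_p_neq0.
have [->|x0] := eqVneq x 0; first by rewrite add0r le_max lexx orbT.
have [->|y0] := eqVneq y 0; first by rewrite addr0 le_max lexx.
wlog le_v : x y x0 y0 / padic_val x <= padic_val y => [hw|].
  have [/hw|/ltW/hw] := leP (padic_val x) (padic_val y); first exact.
  by rewrite addrC maxC; exact.
rewrite le_max; apply/orP; left.
have [u uU xE] := padic_val_decomp x0; have [w wU yE] := padic_val_decomp y0.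
have [n nE] : exists n : nat, padic_val y - padic_val x = n%:Z.
  have : 0 <= padic_val y - padic_val x by rewrite subr_ge0.
  by case: (_ - _) => // n _; exists n.
have -> : x + y = p%:R ^ padic_val x * padic_inj (u + p%:R ^+ n * w).
  rewrite rmorphD rmorphM rmorphXn rmorph_nat mulrDr -xE exprnP -nE mulrA.
  by rewrite -expfzDr // addrCA subrr addr0 -yE.
rewrite [in leRHS]xE !padic_absM ler_wpM2l ?padic_abs_ge0 //.
rewrite [leRHS](_ : _ = 1) ?padic_abs_inj //.
rewrite /padic_abs padic_inj_eq0; case: eqP => [u0|_].
  by move: uU; rewrite u0 unitr0.
by rewrite -[padic_inj u]mul1r -(expr0z p%:R : _ = 1 :> Qp) padic_valE.
Qed.

Lemma padic_dist_xx x : padic_abs (x - x) = 0.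
Proof. by rewrite subrr /padic_abs eqxx. Qed.

Lemma padic_dist_eq0 x y : padic_abs (x - y) = 0 -> x = y.
Proof. by move=> /padic_abs_eq0 /eqP; rewrite subr_eq0 => /eqP. Qed.

Lemma padic_dist_sym x y : padic_abs (x - y) = padic_abs (y - x).
Proof. by rewrite -padic_absN opprB. Qed.

Lemma padic_dist_triangle y x z :
  padic_abs (x - z) <= padic_abs (x - y) + padic_abs (y - z).
Proof.
rewrite -[x - z](subrKA y) (le_trans (padic_abs_ultra _ _)) // ge_max.
by rewrite lerDl lerDr !padic_abs_ge0.
Qed.

HB.instance Definition _ := isMetric.Build R Qp
  padic_dist_xx padic_dist_eq0 padic_dist_sym padic_dist_triangle.

Lemma padic_mdistE x y : mdist x y = padic_abs (x - y).
Proof. by []. Qed.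

End Padic.

Section HausdorffDimension.
Variables (R : realType) (T : metricType R).
Implicit Types (A : set T) (s delta : R).

(* The diameter of set0 is -oo. *)
Definition diameter A : \bar R :=
  ereal_sup [set (mdist z.1 z.2)%:E | z in A `*` A].

(* The empty set has weight 0 also when s = 0, whereas a singleton has weight
   0 `^ 0 = 1 in that case. *)
Definition hausdorff_weight s A : \bar R :=
  if A == set0 then 0%E else (diameter A `^ s)%E.

Definition hausdorff_premeasure s delta A : \bar R :=
  ereal_inf [set (\sum_(0 <= i <oo) hausdorff_weight s (U i))%E |
    U in [set U : nat -> set T |
      (forall i, (diameter (U i) <= delta%:E)%E) /\ A `<=` \bigcup_i U i]].

Definition hausdorff_measure s A : \bar R :=
  ereal_sup [set hausdorff_premeasure s delta A |
    delta in [set delta : R | 0 < delta]].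

Definition hausdorff_dim A : \bar R :=
  ereal_inf [set s%:E |
    s in [set s : R | 0 <= s /\ hausdorff_measure s A = 0%E]].

End HausdorffDimension.

Section Schneider.
Variables (R : realType) (p : nat) (p_pr : prime p).
Local Notation Qp := (padic R p_pr).
Implicit Types (x : Qp) (alpha : R).

Definition pZp : set Qp := [set x | padic_abs x < 1].

Definition schneider_a x : int := padic_val x.

(* The congruence b = p^a / x mod p means p^a / x - b \in p Z_p. *)
Definition schneider_b x : nat :=
  xget 0%N [set b : nat | (0 < b < p)%N /\
                          pZp (p%:R ^ schneider_a x / x - b%:R)].

(* The Schneider map is the restriction of this function to p Z_p. *)
Definition schneider x : Qp :=
  if x == 0 then 0 else p%:R ^ schneider_a x / x - (schneider_b x)%:R.

Lemma schneider_b_unique x (b c : nat) : (0 < b < p)%N -> (0 < c < p)%N ->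
  pZp (p%:R ^ schneider_a x / x - b%:R) ->
  pZp (p%:R ^ schneider_a x / x - c%:R) -> b = c.
Proof.
wlog le_bc : b c / (b <= c)%N => [hw|].
  by have [/hw//|/ltnW/hw hcb hb hc pb pc] := leqP b c; apply/esym/hcb.
move=> /andP[b0 bp] /andP[c0 cp] pb pc; apply/eqP; rewrite eqn_leq le_bc /=.
rewrite -subn_eq0; apply: contraTT (lexx (1 : R)) => cb0; rewrite -ltNge.
set y := _ / x in pb pc.
have : padic_abs ((c - b)%N%:R : Qp) < 1.
  rewrite natrB // (_ : _ - _ = (y - b%:R) + - (y - c%:R)); last first.
    by rewrite opprB [RHS]addrC addrA subrK.
  apply: le_lt_trans (padic_abs_ultra _ _) _.
  by rewrite padic_absN gt_max pb pc.
rewrite -(rmorph_nat (@padic_inj R p p_pr)).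
suff uU : ((c - b)%N%:R : padic_int p_pr) \is a GRing.unit.
  rewrite /padic_abs padic_inj_eq0; case: eqP => [u0|_].
    by move: uU; rewrite u0 unitr0.
  by rewrite -[X in padic_val X]mul1r -(expr0z p%:R : _ = 1 :> Qp) padic_valE.
rewrite padic_int_unitE padic_natrE expn1 modn_small //.
by rewrite (leq_ltn_trans (leq_subr _ _)).
Qed.

Lemma schneider_bP x : x != 0 -> (0 < schneider_b x < p)%N /\
  pZp (p%:R ^ schneider_a x / x - (schneider_b x)%:R).
Proof.
move=> x0; rewrite /schneider_b; case: xgetP => [b _ //|].
have [u uU xE] := padic_val_decomp x0.
have p0 := padic_p_neq0 R p_pr.
have yE : p%:R ^ schneider_a x / x = padic_inj R u^-1.
  by rewrite rmorphV // {2}xE invfM mulrA divff ?mul1r // expfz_neq0.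
set w := u^-1 in yE; have wU : w \is a GRing.unit by rewrite unitrV.
move=> /(_ (w 1%N)); case; split.
  rewrite lt0n -padic_int_unitE wU /= -(padic_digit_mod w 1) expn1.
  by rewrite ltn_mod prime_gt0.
rewrite yE -(rmorph_nat (@padic_inj R p p_pr)) -rmorphB.
have [z ->] : exists z, w - (w 1%N)%:R = p%:R ^+ 1 * z.
  apply: padic_int_divp.
  have : (w - (w 1%N)%:R) 1%N == ((w 1%N)%:R - (w 1%N)%:R : padic_int p_pr) 1%N.
    by rewrite /= !padic_natrE padic_digit_mod.
  by rewrite subrr /= mod0n => /eqP.
rewrite expr1 rmorphM rmorph_nat /pZp /= padic_absM.
rewrite (le_lt_trans (ler_piMr (padic_abs_ge0 _) (padic_abs_inj _ _))) //.
rewrite /padic_abs (negPf p0) (_ : p%:R = p%:R ^ 1 * padic_inj R 1); last first.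
  by rewrite rmorph1 mulr1 expr1z.
rewrite padic_valE ?unitr1 // exprN1 invf_lt1 ?ltr1n ?prime_gt1 //.
by rewrite ltr0n prime_gt0.
Qed.

Lemma schneider_pZp x : pZp (schneider x).
Proof.
rewrite /schneider; case: eqVneq => [_|/schneider_bP[]//].
by rewrite /pZp /= /padic_abs eqxx.
Qed.

Definition schneider_fin : set Qp :=
  [set x | pZp x /\ exists k, iter k schneider x = 0].

Definition schneider_psi x : R := p%:R ^ schneider_a x.

Definition lyapunov_avg x (n : nat) : R :=
  n%:R^-1 * \sum_(0 <= k < n) ln (schneider_psi (iter k schneider x)).

(* This is the Lyapunov exponent only at the points where the limit exists. *)
Definition lyapunov x : R := limn (lyapunov_avg x).

Definition lyapunov_level alpha : set Qp :=
  [set x | [/\ pZp x, ~ schneider_fin x, cvgn (lyapunov_avg x)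
             & lyapunov x = alpha]].

End Schneider.

Arguments pZp R {p} p_pr.
Arguments schneider_fin R {p} p_pr.
Arguments lyapunov_level {R p} p_pr alpha.

Definition log_base (R : realType) (p : nat) (x : R) : R := ln x / ln p%:R.

Definition lyapunov_spectrum (R : realType) (p : nat) (alpha : R) : R :=
  (ln (p%:R - 1) + ln (alpha - ln p%:R) - ln (ln p%:R)
   + alpha * log_base p alpha - alpha * log_base p (alpha - ln p%:R)) / alpha.

(* Main.v *)
Require Import Defs.
From mathcomp Require Import all_boot all_order all_algebra.
From mathcomp Require Import all_classical all_reals all_analysis.
From mathcomp Require Import ring lra zify.
Set Implicit Arguments.
Unset Strict Implicit.
Unset Printing Implicit Defensive.
Import Order.TTheory GRing.Theory Num.Theory.
Import numFieldNormedType.Exports.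
Local Open Scope classical_set_scope.
Local Open Scope ring_scope.

(** Let [L = ln p] and [t = alpha / L].  A point of [p Z_p] whose orbit avoids
    0 is coded by the sequence of its digits [(a_i, b_i)], with [a_i >= 1] and
    [1 <= b_i < p]; every such sequence occurs ([exists_digits]).  Since
    [x = p^a / (b + T x)] with [b + T x] of absolute value 1, prescribing [n]
    digits of total weight [S = a_1 + ... + a_n] confines [x] to a set of
    diameter at most [p^-S] ([digit_word_dist]), and conversely two points
    closer than [p^-S] share these digits ([close_digit_word]).  So the metric
    is read off the weights, and the level set consists of the points with
    [S_n / n --> t].

    There are [(p-1)^n * 'C(S-1, n-1)] words of length [n] and weight [S], and
    for [S ~ t n] the logarithm of this number is about
    [n (ln (p-1) + entropy t)], where
    [entropy t = t ln t - (t-1) ln (t-1)].  Comparing with the diameter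
    [exp (- t n L)] gives the dimension [(ln (p-1) + entropy t) / alpha], which
    is the stated spectrum ([spectrum_entropy]).

    Upper bound ([level_measure_eq0]).  Give the digits a product law, [b]
    uniform and [a] geometric of ratio [r].  For [r] close to [(t-1)/t] and [s]
    above the expected dimension, [p^(- s S)] is at most [exp (- c n)] times the
    mass of the word as soon as [S / n] is close to [t] ([covering_rate]).  A
    point of the level set lies in such a cylinder for every large [n], so all
    these cylinders with [n >= M] form a cover, and its [s]-sum is at most a
    geometric tail in [M].

    Lower bound ([level_measure_neq0]).  Fix a block length [k] and consider the
    points whose digits are arbitrary concatenations of [N] admissible blocks,
    the last digit of each block being enlarged so that the weight after [q]
    blocks is exactly [floor (t k q)].  These points are in the level set, and
    they form a homogeneous tree: [N] children per node, diameter about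
    [p^(- t k q)] at depth [q].  The mass distribution principle for such trees
    ([coded_set_measure_neq0]) gives the dimension bound
    [ln N / (t k L)].  It is proved without constructing a measure: a family of
    cylinders of total mass less than 1 does not cover the tree, because one can
    always descend to a child whose share of the family is smaller than its own
    mass ([exists_branch]).  Stirling-type bounds on factorials make
    [ln N / k] arbitrarily close to [ln (p-1) + entropy t]
    ([composition_entropy]). *)

Lemma exprn_small (R : realType) (q e : R) : 0 < q < 1 -> 0 < e ->
  exists N, forall n, (N <= n)%N -> q ^+ n <= e.
Proof.
move=> /andP[q0 q1] e0; have : geometric 1 q @ \oo --> (0 : R).
  by apply: cvg_geometric; rewrite gtr0_norm.
move=> /cvgr0_norm_le /(_ _ e0)[N _ HN]; exists N => n /HN /=.
by rewrite mul1r; apply: le_trans; exact: ler_norm.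
Qed.

(** * Hausdorff measure: covers and homogeneous trees *)

Section Tree.
Variables (R : realType) (W : finType).
Local Notation N := (#|W|%:R : R).

(** A word that properly extends [v] contains exactly one of its children
    [rcons v w], so mass attached to [m] is never counted twice among them. *)
Lemma sum_prefix_rcons (c : \bar R) (v m : seq W) : (0 <= c)%E ->
  (\sum_(w : W) (if prefix (rcons v w) m then c else 0) <=
   if prefix v m then c else 0)%E.
Proof.
move=> c0; have [/existsP[w0 pw0]|/existsPn np] :=
  boolP [exists w, prefix (rcons v w) m]; last first.
  rewrite big1 => [|w _]; first by case: ifP.
  by rewrite (negPf (np w)).
have -> : prefix v m.
  by move: pw0; rewrite -cats1 => /prefixP[u ->]; rewrite -catA prefix_prefix.
rewrite (bigD1 w0) //= pw0 big1 ?adde0 // => w ww0.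
case: ifP => // /prefixP[u mE]; move: pw0; rewrite mE => /prefixP[u'].
move=> /(congr1 (fun z => nth w z (size v))).
rewrite -!cats1 -!catA !nth_cat !ltnn subnn /= => E.
by rewrite E eqxx in ww0.
Qed.

(** Cylinders of total mass less than 1 do not cover the sequence space, where a
    cylinder fixing [k] letters has mass [N^-k].  Call a node good when the
    cylinders inside it have total mass less than its own: the root is good, and
    since the masses of the children add up, a good node has a good child.  The
    branch obtained by descending forever avoids every cylinder, for a node that is
    one of the cylinders is not good. *)
Lemma exists_branch (s : nat -> nat -> W) (k : nat -> nat) :
  (\sum_(0 <= i <oo) (N ^- k i)%:E < 1)%E ->
  exists t : nat -> W, forall i, exists2 j, (j < k i)%N & t j != s i j.
Proof.
move=> sum_lt1.
have c0 i : (0 <= (N ^- k i)%:E)%E by rewrite lee_fin invr_ge0 exprn_ge0.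
pose bad v := (\sum_(0 <= i <oo)
  (if prefix v (mkseq (s i) (k i)) then (N ^- k i)%:E else 0))%E.
pose good v := (bad v < (N ^- size v)%:E)%E.
have good0 : good [::].
  rewrite /good /bad expr0 invr1; apply: le_lt_trans sum_lt1.
  apply: lee_nneseries => i _; first by case: ifP.
  by rewrite prefix0s.
(* If no child were good, the cylinders below them would weigh at least as
   much as [v]. *)
have step v : good v -> exists w, good (rcons v w).
  move=> gv; apply: contrapT => /forallNP ng.
  move: gv; rewrite /good ltNge => /negP; apply.
  have : (\sum_(w : W) (N ^- (size v).+1)%:E <= bad v)%E.
    apply: (@le_trans _ _ (\sum_(w : W) bad (rcons v w))%E).
      apply: lee_sum => w _; have /negP := ng w.
      by rewrite /good size_rcons -leNgt.
    rewrite /bad -nneseries_sum; last by move=> w i _; case: ifP.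
    apply: lee_nneseries => i _; last exact: sum_prefix_rcons.
    by move=> _; apply: sume_ge0 => w _; case: ifP.
  apply: le_trans; rewrite sumEFin lee_fin sumr_const.
  rewrite exprS invfM -mulrnAl -(mulr_natl (N^-1)).
  have [w _|W0] := pickP (predT : pred W).
    rewrite mulfV ?mul1r // pnatr_eq0 -lt0n; apply/card_gt0P.
    by exists w.
  exfalso; have N0 : #|W| = 0%N by apply: eq_card0.
  by have := W0 (s 0%N 0%N).
have [f fP] : exists f : seq W -> W, forall v, good v -> good (rcons v (f v)).
  suff /choice[f fP] : forall v, exists w, good v -> good (rcons v w) by exists f.
  move=> v.
  have [gv|ngv] := pselect (good v); last by exists (s 0%N 0%N).
  by have [w] := step v gv; exists w.
pose V := fix V n := if n is m.+1 then rcons (V m) (f (V m)) else [::].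
have goodV n : good (V n) by elim: n => // n /fP.
have Vmk n : V n = mkseq (fun j => f (V j)) n.
  by elim: n => // n IH; rewrite mkseqS -IH.
(* Were the branch in the [i]-th cylinder, that cylinder would be the node
   [V (k i)], which is good. *)
exists (fun j => f (V j)) => i; apply: contrapT => agree.
have E : mkseq (s i) (k i) = V (k i).
  rewrite Vmk; apply/eq_in_map => j; rewrite mem_iota => /= jk.
  by apply/eqP/negPn/negP => ne; apply: agree; exists j; rewrite // eq_sym.
have := goodV (k i); rewrite /good ltNge => /negP; apply.
rewrite Vmk size_mkseq -Vmk /bad (nneseriesD1 (n := i)) //.
  by rewrite E prefix_refl leeDl // nneseries_ge0 // => j _ _; case: ifP.
by move=> j _; case: ifP.
Qed.

End Tree.

Section Hausdorff.
Variables (R : realType) (T : metricType R).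
Implicit Types (A U : set T) (s d : R).

Lemma diameter_le A d : (forall x y, A x -> A y -> mdist x y <= d) ->
  (diameter A <= d%:E)%E.
Proof.
move=> Ad; apply: ge_ereal_sup => _ [[x y] [/= Ax Ay] <-].
by rewrite lee_fin Ad.
Qed.

Lemma mdist_le_diameter A x y : A x -> A y -> ((mdist x y)%:E <= diameter A)%E.
Proof. by move=> Ax Ay; apply: ereal_sup_ubound; exists (x, y). Qed.

Lemma hausdorff_weight_ge0 s A : (0 <= hausdorff_weight s A)%E.
Proof. by rewrite /hausdorff_weight; case: ifP => // _; exact: poweR_ge0. Qed.

Lemma hausdorff_weight_le s A d : 0 <= s -> 0 <= d ->
  (diameter A <= d%:E)%E -> (hausdorff_weight s A <= (d `^ s)%:E)%E.
Proof.
move=> s0 d0 Ad; rewrite /hausdorff_weight; case: eqVneq => [_|/set0P[x Ax]].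
  by rewrite lee_fin powR_ge0.
have A0 : (0 <= diameter A)%E.
  by apply: le_trans (mdist_le_diameter Ax Ax); rewrite lee_fin mdist_ge0.
rewrite -poweR_EFin gt0_ler_poweR //.
- by rewrite in_itv /= A0 leey.
- by rewrite in_itv /= leey lee_fin d0.
Qed.

Lemma hausdorff_premeasure_ge0 s d A : (0 <= hausdorff_premeasure s d A)%E.
Proof.
apply: le_ereal_inf_tmp => _ [U _ <-]; apply: nneseries_ge0 => i _ _.
exact: hausdorff_weight_ge0.
Qed.

(** This is how the measure is shown to vanish: it suffices to exhibit, for every
    mesh, covers of arbitrarily small sum. *)
Lemma hausdorff_measure_eq0 s A :
  (forall d e, 0 < d -> 0 < e -> exists U : nat -> set T,
     [/\ forall i, (diameter (U i) <= d%:E)%E, A `<=` \bigcup_i U i &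
         (\sum_(0 <= i <oo) hausdorff_weight s (U i) <= e%:E)%E]) ->
  hausdorff_measure s A = 0%E.
Proof.
move=> cov; apply/eqP; rewrite eq_le; apply/andP; split.
  apply: ge_ereal_sup => _ [d d0 <-]; apply/lee_addgt0Pr => e e0.
  have [U [Ud AU Ue]] := cov d e d0 e0; rewrite add0e.
  by apply: le_trans Ue; apply: ereal_inf_lbound; exists U.
apply: le_trans (hausdorff_premeasure_ge0 s 1 A) _.
by apply: ereal_sup_ubound; exists 1 => //; exact: ltr01.
Qed.

Lemma hausdorff_dim_le A D : 0 <= D ->
  (forall s, D < s -> hausdorff_measure s A = 0%E) ->
  (hausdorff_dim A <= D%:E)%E.
Proof.
move=> D0 HA; apply/lee_addgt0Pr => e e0; apply: ereal_inf_lbound.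
exists (D + e) => //; split; first by rewrite addr_ge0 // ltW.
by rewrite HA // ltrDl.
Qed.

Lemma le_hausdorff_dim A D :
  (forall s, 0 <= s -> s < D -> hausdorff_measure s A != 0%E) ->
  (D%:E <= hausdorff_dim A)%E.
Proof.
move=> HA; apply: le_ereal_inf_tmp => _ [s [s0 As] <-].
by rewrite lee_fin leNgt; apply/negP => /(HA s s0); rewrite As eqxx.
Qed.

(** Mass distribution principle for a homogeneous tree.  By separation, a set of
    diameter [d < rho k] meets the coded set inside a single node of depth [k].
    For the largest such [k] the mass [N^-k] of this node is at most [N * d `^ s], so
    a cover of small [s]-sum would yield cylinders of total mass less than 1,
    contradicting [exists_branch]. *)
Lemma coded_set_measure_neq0 (W : finType) (x : (nat -> W) -> T)
    (rho : nat -> R) s A :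
  (1 < #|W|)%N -> 0 <= s ->
  (forall k, 0 < rho k) ->
  (forall t u k, mdist (x t) (x u) < rho k ->
     forall j, (j < k)%N -> t j = u j) ->
  (forall k, #|W|%:R ^- k <= rho k `^ s) ->
  (forall t, A (x t)) -> hausdorff_measure s A != 0%E.
Proof.
move=> W1 s0 rho0 sep mass Ax; set N := #|W|%:R : R.
have N1 : 1 < N by rewrite ltr1n.
have N0 : 0 < N by apply: lt_trans N1.
have small (e : R) : 0 < e -> exists k, N ^- k <= e.
  have N01 : 0 < N^-1 < 1 by rewrite invr_gt0 N0 invf_lt1.
  by move=> /(exprn_small N01)[k Hk]; exists k; rewrite -exprVn Hk.
(* The term [e] takes care of [d = 0], where no depth is maximal; it is made
   summable along the cover. *)
have lvl (e d : R) : 0 < e < 1 -> 0 <= d < rho 0%N ->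
    exists k, d < rho k /\ N ^- k <= N * (d `^ s + e).
  move=> /andP[e0 e1] /andP[d0 dr].
  have ex : exists k, (N ^- k <= e) || (rho k <= d).
    by have [k ke] := small e e0; exists k; rewrite ke.
  case: (ex_minnP ex) => -[|k] Pk mink.
    by move: Pk; rewrite expr0 invr1 !leNgt e1 dr.
  exists k; split.
    rewrite ltNge; apply/negP => rk; have := mink k.
    by rewrite rk orbT ltnn => /(_ isT).
  have -> : N ^- k = N * N ^- k.+1.
    by rewrite exprS invfM mulVKf // gt_eqF.
  rewrite ler_pM2l //; case/orP: Pk => [ke|rd].
    by apply: le_trans ke _; rewrite lerDr powR_ge0.
  apply: le_trans (mass k.+1) _; apply: (@le_trans _ _ (d `^ s)).
    by rewrite ge0_ler_powR // ?nnegrE // ltW.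
  by rewrite lerDl ltW.
(* The [s]-sum and the error terms contribute at most [c] each, and
   [N * (c + c) < 1]. *)
pose c := (4 * N)^-1; have c0 : 0 < c by rewrite invr_gt0 mulr_gt0.
have c1 : c < 1.
  by rewrite invf_lt1 ?mulr_gt0 //; move: N1; lra.
suff low : (c%:E <= hausdorff_premeasure s (rho 0%N / 2) A)%E.
  rewrite gt_eqF //; apply: (@lt_le_trans _ _ c%:E); rewrite ?lte_fin //.
  apply: le_trans low _; apply: ereal_sup_ubound; exists (rho 0%N / 2) => //=.
  by rewrite divr_gt0.
apply: le_ereal_inf_tmp => _ [U [Ud AU] <-]; rewrite leNgt; apply/negP => Uc.
have sel i : exists tk : (nat -> W) * nat,
    (forall t, U i (x t) -> forall j, (j < tk.2)%N -> t j = tk.1 j) /\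
    ((N ^- tk.2)%:E <=
       N%:E * (hausdorff_weight s (U i) + (c / (2 ^ i.+1)%:R)%:E))%E.
  have e01 : 0 < c / (2 ^ i.+1)%:R < 1.
    rewrite divr_gt0 ?ltr0n ?expn_gt0 //= ltr_pdivrMr ?ltr0n ?expn_gt0 //.
    by rewrite mul1r (lt_le_trans c1) // ler1n expn_gt0.
  have [[t Ut]|nU] := pselect (exists t, U i (x t)); last first.
    have w0 : W by move: W1; case: (pickP (predT : pred W)) => // W0; rewrite eq_card0.
    have [|k Hk] := small (N * (c / (2 ^ i.+1)%:R)).
      by rewrite mulr_gt0 //; case/andP: e01.
    exists (fun=> w0, k); split; first by move=> t Ut; case: nU; exists t.
    apply: (@le_trans _ _ (N%:E * (c / (2 ^ i.+1)%:R)%:E)%E).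
      by rewrite -EFinM lee_fin.
    rewrite lee_pmul2l ?lte_fin // leeDr //; exact: hausdorff_weight_ge0.
  have := Ud i; have := mdist_le_diameter Ut Ut.
  (* The mesh and the point [x t] rule out the infinite values of the diameter. *)
  have : diameter (U i) = diameter (U i) by [].
  case: {2 3 4}(diameter (U i)) => [d|//|//] dE.
  rewrite !lee_fin => /(le_trans (mdist_ge0 _ _)) d0 dr.
  have [|k [dk Nk]] := lvl _ d e01.
    by rewrite d0 (le_lt_trans dr) // ltr_pdivrMr // ltr_pMr // ltr1n.
  exists (t, k); split => /=.
    move=> u Uu j jk; apply: (sep u t k) => //; apply: le_lt_trans dk.
    by rewrite -lee_fin -dE; exact: mdist_le_diameter.
  rewrite /hausdorff_weight dE poweR_EFin; case: eqVneq => [U0|_].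
    by move: Ut; rewrite U0.
  by rewrite -EFinD -EFinM lee_fin.
have [g gP] := choice sel.
have [|t tP] := @exists_branch R W (fun i => (g i).1) (fun i => (g i).2).
  apply: (@le_lt_trans _ _ (\sum_(0 <= i <oo)
     N%:E * (hausdorff_weight s (U i) + (c / (2 ^ i.+1)%:R)%:E))%E).
    apply: lee_nneseries => i _; last by case: (gP i).
    by rewrite lee_fin invr_ge0 exprn_ge0 // ltW.
  have w0 i : (0 <= hausdorff_weight s (U i))%E by exact: hausdorff_weight_ge0.
  rewrite nneseriesZl; last first.
    by move=> i _; rewrite adde_ge0 // lee_fin divr_ge0 // ltW.
  apply: (@le_lt_trans _ _ (N%:E * (c%:E + c%:E))%E).
    rewrite lee_pmul2l ?lte_fin //.
    apply: le_trans (epsilon_trick _ _ _) _ => //; first exact: ltW.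
    by rewrite leeD2r // ltW.
  rewrite -EFinD -EFinM lte_fin /c invfM.
  have -> : N * (4^-1 * N^-1 + 4^-1 * N^-1) = 2^-1 by field; rewrite gt_eqF.
  by rewrite invf_lt1 // ltr1n.
have [i _ Ui] := AU _ (Ax t); have [j jk] := tP i.
by case: (gP i) => /(_ t Ui j jk) -> _; rewrite eqxx.
Qed.

End Hausdorff.

(** * Digits of the Schneider map *)

Lemma mobiusB (F : fieldType) (c b y z : F) : b + y != 0 -> b + z != 0 ->
  c / (b + y) - c / (b + z) = c * (z - y) / (b + y) / (b + z).
Proof. by move=> by0 bz0; field; rewrite by0 bz0. Qed.

Lemma mulf_divB (F : fieldType) (c x y : F) : x != 0 -> y != 0 ->
  c / x = c / y + c * (y - x) / x / y.
Proof. by move=> x0 y0; field; rewrite x0 y0. Qed.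

Lemma divf_divK (F : fieldType) (c x : F) : c != 0 -> c / (c / x) = x.
Proof. by move=> c0; rewrite invf_div mulrC divfK. Qed.

Section SchneiderDigits.
Variables (R : realType) (p : nat) (p_pr : prime p).
Local Notation Zp := (padic_int p_pr).
Local Notation Qp := (padic R p_pr).
Local Notation T := (@schneider R p p_pr).
Implicit Types (x y z : Qp) (u v : Zp).

Let p0 : 0 < p%:R :> R. Proof. by rewrite ltr0n prime_gt0. Qed.
Let p1 : 1 < p%:R :> R. Proof. by rewrite ltr1n prime_gt1. Qed.

Lemma padic_abs_unit u : u \is a GRing.unit -> padic_abs (padic_inj R u) = 1.
Proof.
move=> uU; rewrite /padic_abs padic_inj_eq0; case: eqP => [u0|_].
  by move: uU; rewrite u0 unitr0.
by rewrite -[padic_inj R u]mul1r -(expr0z p%:R : _ = 1 :> Qp) padic_valE.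
Qed.

Lemma padic_abs1 : padic_abs (1 : Qp) = 1.
Proof. by rewrite -(rmorph1 (@padic_inj R p p_pr)) padic_abs_unit ?unitr1. Qed.

Lemma padic_abs0 : padic_abs (0 : Qp) = 0.
Proof. by rewrite /padic_abs eqxx. Qed.

Lemma padic_abs_expz k : padic_abs (p%:R ^ k : Qp) = p%:R ^ (- k).
Proof.
rewrite /padic_abs (negPf (expfz_neq0 _ (padic_p_neq0 R p_pr))).
by rewrite -[p%:R ^ k]mulr1 -(rmorph1 (@padic_inj R p p_pr)) padic_valE ?unitr1.
Qed.

Lemma padic_absV x : padic_abs x^-1 = (padic_abs x)^-1.
Proof.
have [->|x0] := eqVneq x 0; first by rewrite !invr0 padic_abs0 invr0.
apply: (@mulfI _ (padic_abs x)).
  by apply: contraNneq x0 => /padic_abs_eq0 ->.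
rewrite -padic_absM mulfV // padic_abs1 mulfV //.
by apply: contraNneq x0 => /padic_abs_eq0 ->.
Qed.

Lemma padic_abs_val x : x != 0 -> padic_abs x = p%:R ^ (- schneider_a x).
Proof. by rewrite /padic_abs => /negPf ->. Qed.

Lemma padic_val_eq x k : x != 0 -> padic_abs x = p%:R ^ (- k) ->
  schneider_a x = k.
Proof.
move=> x0; rewrite padic_abs_val // => /(ieexprIz p0) E; apply: oppr_inj.
by apply: E; rewrite gt_eqF.
Qed.

Lemma padic_val_gt0 x : x != 0 -> pZp R p_pr x -> 0 < schneider_a x.
Proof.
move=> x0; rewrite /pZp /= padic_abs_val //.
by rewrite -[ltRHS](expr0z p%:R) ltr_eXz2l // oppr_lt0.
Qed.

(** A nonzero digit is a unit, and adding an element of the maximal ideal does not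
    change this: the denominators of the continued fraction are isometric factors. *)
Lemma padic_abs_digit_add (b : nat) y : (0 < b < p)%N -> pZp R p_pr y ->
  padic_abs (b%:R + y) = 1.
Proof.
move=> /andP[b0 bp] y1; have b1 : padic_abs (b%:R : Qp) = 1.
  rewrite -(rmorph_nat (@padic_inj R p p_pr)) padic_abs_unit //.
  by rewrite padic_int_unitE padic_natrE expn1 modn_small // -lt0n.
apply/eqP; rewrite eq_le; apply/andP; split.
  by apply: le_trans (padic_abs_ultra _ _) _; rewrite b1 ge_max lexx ltW.
have := padic_abs_ultra (b%:R + y) (- y); rewrite addrK b1 padic_absN.
by rewrite le_max => /orP[//|]; rewrite leNgt y1.
Qed.

(** The inverse branches of the Schneider map are the maps
    [y |-> p^a / (b + y)]; they have disjoint images, so they determine the digits. *)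
Lemma schneider_inv (a : int) (b : nat) y x : (0 < b < p)%N -> pZp R p_pr y ->
  x = p%:R ^ a / (b%:R + y) ->
  [/\ x != 0, schneider_a x = a, schneider_b x = b & T x = y].
Proof.
move=> b0p y1 xE; have by1 := padic_abs_digit_add b0p y1.
have by0 : b%:R + y != 0.
  by apply/eqP => E; move: by1; rewrite E padic_abs0 => /esym/eqP; rewrite oner_eq0.
have pa0 := expfz_neq0 a (padic_p_neq0 R p_pr).
have x0 : x != 0 by rewrite xE mulf_neq0 ?invr_eq0.
have xa : schneider_a x = a.
  by apply: padic_val_eq; rewrite // xE padic_absM padic_absV by1 invr1 mulr1
    padic_abs_expz.
have pax : p%:R ^ a / x = b%:R + y by rewrite xE divf_divK.
have xb : schneider_b x = b.
  have [bp bx] := schneider_bP x0.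
  apply: (schneider_b_unique bp b0p bx).
  by rewrite xa pax addrAC subrr add0r.
split=> //; rewrite /schneider (negPf x0) xa xb pax.
by rewrite addrAC subrr add0r.
Qed.

Lemma schneider_eq x : x != 0 ->
  x = p%:R ^ schneider_a x / ((schneider_b x)%:R + T x).
Proof.
move=> x0; rewrite /schneider (negPf x0) addrC subrK divf_divK //.
exact: expfz_neq0 (padic_p_neq0 R p_pr).
Qed.

(** Each inverse branch is a similarity of ratio [p^-a], since the cross
    denominators have absolute value 1. *)
Lemma mobius_dist (a : int) (b : nat) y z : (0 < b < p)%N ->
  pZp R p_pr y -> pZp R p_pr z ->
  padic_abs (p%:R ^ a / (b%:R + y) - p%:R ^ a / (b%:R + z)) =
  p%:R ^ (- a) * padic_abs (y - z).
Proof.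
move=> b0p y1 z1.
have by1 := padic_abs_digit_add b0p y1; have bz1 := padic_abs_digit_add b0p z1.
have n0 (w : Qp) : padic_abs w = 1 -> w != 0.
  by move=> w1; apply/eqP => w0; move: w1; rewrite w0 padic_abs0 => /esym/eqP;
    rewrite oner_eq0.
rewrite mobiusB ?n0 // !padic_absM !padic_absV by1 bz1 invr1 !mulr1 padic_abs_expz.
by rewrite padic_dist_sym.
Qed.

Lemma schneider_dist x y : x != 0 -> y != 0 ->
  schneider_a x = schneider_a y -> schneider_b x = schneider_b y ->
  padic_abs (x - y) = p%:R ^ (- schneider_a x) * padic_abs (T x - T y).
Proof.
move=> x0 y0 ea eb; have [b0p _] := schneider_bP x0.
rewrite {1}(schneider_eq x0) {1}(schneider_eq y0) -ea -eb.
exact: (mobius_dist _ b0p (schneider_pZp x) (schneider_pZp y)).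
Qed.

(** In an ultrametric, being closer to [x] than 0 is forces equal absolute values,
    hence the same [a]; the distance is then small enough to fix the residue of
    [p^a / x] as well. *)
Lemma close_same_digits x y : x != 0 -> y != 0 ->
  padic_abs (x - y) < padic_abs x ->
  schneider_a x = schneider_a y /\ schneider_b x = schneider_b y.
Proof.
move=> x0 y0 xy.
have yx : padic_abs y = padic_abs x.
  apply/eqP; rewrite eq_le; apply/andP; split.
    have := padic_abs_ultra x (y - x); rewrite addrC subrK => /le_trans; apply.
    by rewrite ge_max lexx padic_dist_sym ltW.
  have := padic_abs_ultra y (x - y); rewrite addrC subrK le_max.
  by case/orP => //; rewrite leNgt xy.
have ayx : schneider_a y = schneider_a x.
  by apply: padic_val_eq => //; rewrite yx padic_abs_val.
split=> //; have [bx px] := schneider_bP x0; have [by_ py] := schneider_bP y0.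
apply: (schneider_b_unique bx by_ px).
have -> : p%:R ^ schneider_a x / x - (schneider_b y)%:R =
    (p%:R ^ schneider_a y / y - (schneider_b y)%:R) +
    p%:R ^ schneider_a x * (y - x) / x / y.
  by rewrite (mulf_divB _ x0 y0) addrAC ayx.
rewrite /pZp /=; apply: le_lt_trans (padic_abs_ultra _ _) _.
rewrite gt_max py /= !padic_absM !padic_absV yx padic_abs_expz.
rewrite -(padic_abs_val x0) padic_dist_sym.
have r0 : 0 < padic_abs x.
  rewrite lt_def padic_abs_ge0 andbT.
  by apply: contraNneq x0 => /padic_abs_eq0 ->.
have -> : padic_abs x * padic_abs (x - y) / padic_abs x / padic_abs x =
          padic_abs (x - y) / padic_abs x by field; rewrite gt_eqF.
by rewrite ltr_pdivrMr ?mul1r.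
Qed.

Definition digit x : nat * nat := (`|schneider_a x|%N, schneider_b x).

Definition digit_word x n : seq (nat * nat) :=
  [seq digit (iter k T x) | k <- iota 0 n].

Definition weight (w : seq (nat * nat)) : nat := \sum_(d <- w) d.1.

Lemma weight_cons d w : weight (d :: w) = (d.1 + weight w)%N.
Proof. by rewrite /weight big_cons. Qed.

Definition infinite_expansion x := pZp R p_pr x /\ ~ schneider_fin R p_pr x.

Lemma size_digit_word x n : size (digit_word x n) = n.
Proof. by rewrite size_map size_iota. Qed.

Lemma digit_wordS x n : digit_word x n.+1 = digit x :: digit_word (T x) n.
Proof.
rewrite /digit_word /= -[1%N]addn0 iotaDl -map_comp; congr cons.
by apply: eq_map => k; congr digit; exact: iterSr.
Qed.

Lemma infinite_expansion_neq0 x : infinite_expansion x -> x != 0.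
Proof.
by move=> [x1 xF]; apply/eqP => x0; apply: xF; split=> //; exists 0%N.
Qed.

Lemma infinite_expansionS x : infinite_expansion x -> infinite_expansion (T x).
Proof.
move=> [x1 xF]; split; first exact: schneider_pZp.
by move=> [_ [k Tk]]; apply: xF; split=> //; exists k.+1; rewrite iterSr.
Qed.

Lemma infinite_expansion_iter x n :
  infinite_expansion x -> infinite_expansion (iter n T x).
Proof. by move=> xi; elim: n => //= n; exact: infinite_expansionS. Qed.

Lemma digit_a x : infinite_expansion x -> schneider_a x = (digit x).1%:Z.
Proof.
move=> xi; rewrite /digit /= gez0_abs // ltW // padic_val_gt0 //.
  exact: infinite_expansion_neq0.
by case: xi.
Qed.

Lemma digit_valid x : infinite_expansion x ->
  (0 < (digit x).1)%N /\ (0 < (digit x).2 < p)%N.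
Proof.
move=> xi; have x0 := infinite_expansion_neq0 xi.
split; last by case: (schneider_bP x0).
by rewrite -ltz_nat -digit_a // padic_val_gt0 //; case: xi.
Qed.

(** Each digit contracts by [p^-a], starting from the bound 1 on [p Z_p]. *)
Lemma digit_word_dist n x y : infinite_expansion x -> infinite_expansion y ->
  digit_word x n = digit_word y n ->
  padic_abs (x - y) <= p%:R ^- weight (digit_word x n).
Proof.
elim: n x y => [|n IH] x y xi yi.
  move=> _; rewrite /weight big_nil expr0 invr1.
  apply: le_trans (padic_abs_ultra _ _) _; rewrite padic_absN ge_max.
  by rewrite !ltW //; [case: yi | case: xi].
move=> /eqP; rewrite !digit_wordS eqseq_cons => /andP[/eqP ed /eqP ew].
have IHn := IH _ _ (infinite_expansionS xi) (infinite_expansionS yi) ew.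
have xA := digit_a xi; have yA := digit_a yi.
have x0 := infinite_expansion_neq0 xi; have y0 := infinite_expansion_neq0 yi.
have eb : schneider_b x = schneider_b y := congr1 snd ed.
have ea : schneider_a x = schneider_a y by rewrite xA yA ed.
rewrite (schneider_dist x0 y0 ea eb) weight_cons exprD invfM xA -exprnN.
apply: (ler_wpM2l _ IHn); rewrite invr_ge0 exprn_ge0 //; exact: ltW.
Qed.

(** Converse of [digit_word_dist]: a common digit expands the distance by [p^a] and
    uses up [a] from the weight, so the images under [T] are again close enough. *)
Lemma close_digit_word n x y : infinite_expansion x -> infinite_expansion y ->
  padic_abs (x - y) < p%:R ^- weight (digit_word x n) ->
  digit_word x n = digit_word y n.
Proof.
elim: n x y => [//|n IH] x y xi yi; rewrite !digit_wordS weight_cons => xy.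
have xA := digit_a xi.
have x0 := infinite_expansion_neq0 xi; have y0 := infinite_expansion_neq0 yi.
have w1 : p%:R ^- weight (digit_word (T x) n) <= 1 :> R.
  by rewrite invf_le1 ?exprn_gt0 // exprn_ege1 // ltW.
have [|ea eb] := close_same_digits x0 y0.
  apply: lt_le_trans xy _.
  by rewrite padic_abs_val // xA -exprnN exprD invfM ler_piMr.
have -> : digit x = digit y by rewrite /digit ea eb.
suff -> : digit_word (T x) n = digit_word (T y) n by [].
apply: (IH _ _ (infinite_expansionS xi) (infinite_expansionS yi)).
move: xy; rewrite (schneider_dist x0 y0 ea eb) xA -exprnN exprD invfM ltr_pM2l //.
by rewrite invr_gt0 exprn_gt0.
Qed.

End SchneiderDigits.

Section SchneiderExistence.
Variables (R : realType) (p : nat) (p_pr : prime p).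
Local Notation Zp := (padic_int p_pr).
Local Notation Qp := (padic R p_pr).
Local Notation T := (@schneider R p p_pr).
Implicit Types (x y : Qp) (u v : Zp).

Let p0 : 0 < p%:R :> R. Proof. by rewrite ltr0n prime_gt0. Qed.
Let p1 : 1 < p%:R :> R. Proof. by rewrite ltr1n prime_gt1. Qed.

Lemma padic_abs_pexpM n u :
  padic_abs (padic_inj R (p%:R ^+ n * u)) = p%:R ^- n * padic_abs (padic_inj R u).
Proof.
rewrite rmorphM rmorphXn rmorph_nat padic_absM; congr (_ * _).
by rewrite -[p%:R ^+ n]/(p%:R ^ n%:Z) padic_abs_expz exprnN.
Qed.

Lemma padic_eqmodP u v n :
  u n = v n <-> padic_abs (padic_inj R (u - v)) <= p%:R ^- n.
Proof.
split=> [uvn|].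
  have [z ->] : exists z, u - v = p%:R ^+ n * z.
    apply: padic_int_divp; have -> : padic_digits (u - v) n = padic_digits (v - v) n by rewrite /= uvn.
    by rewrite subrr /= mod0n.
  rewrite padic_abs_pexpM ler_piMr ?padic_abs_inj // invr_ge0 exprn_ge0 //; exact: ltW.
have [/eqP|uv0] := eqVneq (u - v) 0; first by rewrite subr_eq0 => /eqP ->.
have [m [z [zU zE]]] := padic_int_decomp uv0.
rewrite zE padic_abs_pexpM padic_abs_unit // mulr1 lef_pV2 ?posrE ?exprn_gt0 // ler_eXn2l // => nm.
have -> : u = v + p%:R ^+ n * (p%:R ^+ (m - n) * z).
  by rewrite mulrA -exprD subnKC // -zE addrC subrK.
rewrite -natrX /= !padic_natrE modnn.
by rewrite mul0n mod0n addn0 padic_digit_mod.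
Qed.

(** The truncations [g n n] are compatible residues, so they define the limit in the
    inverse limit. *)
Lemma padic_int_complete (g : nat -> Zp) :
  (forall n, padic_abs (padic_inj R (g n - g n.+1)) <= p%:R ^- n) ->
  exists u, forall n, padic_abs (padic_inj R (u - g n)) <= p%:R ^- n.
Proof.
move=> gP; have fc n : (g n n = g n.+1 n.+1 %[mod p ^ n])%N.
  have /padic_eqmodP -> := gP n.
  by rewrite -padic_intP padic_digit_mod.
exists (padic_lim p_pr fc) => n; apply/padic_eqmodP.
by rewrite /= padic_digit_mod.
Qed.

Definition valid_digits (d : nat -> nat * nat) :=
  forall i, (0 < (d i).1)%N /\ (0 < (d i).2 < p)%N.

(** Finite continued fractions, computed in [Z_p] so that their limit is available
    there. *)
Fixpoint convergent (d : nat -> nat * nat) n : Zp :=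
  if n is m.+1 then
    p%:R ^+ (d 0%N).1 / ((d 0%N).2%:R + convergent (fun i => d i.+1) m)
  else 0.

Lemma convergent_pZp d n : valid_digits d ->
  pZp R p_pr (padic_inj R (convergent d n)).
Proof.
move=> dv; case: n => [|n] /=; first by rewrite /pZp /= rmorph0 padic_abs0.
rewrite /pZp /= padic_abs_pexpM.
apply: (@le_lt_trans _ _ (p%:R ^- (d 0%N).1)).
  by rewrite ler_piMr ?padic_abs_inj // invr_ge0 exprn_ge0 // ltW.
by rewrite invf_lt1 ?exprn_gt0 // exprn_egt1 // -lt0n; case: (dv 0%N).
Qed.

(** Inversion in [Z_p] agrees with inversion in [Q_p] only for units; the
    denominator is one, by [padic_abs_digit_add]. *)
Lemma convergentS d n : valid_digits d ->
  padic_inj R (convergent d n.+1) = p%:R ^ (d 0%N).1%:Z /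
    ((d 0%N).2%:R + padic_inj R (convergent (fun i => d i.+1) n)).
Proof.
move=> dv; set v := convergent (fun i => d i.+1) n.
have [_ b0p] := dv 0%N; have dv' : valid_digits (fun i => d i.+1).
  by move=> i; exact: dv.
have bv1 := padic_abs_digit_add b0p (convergent_pZp n dv'); rewrite -/v in bv1.
have vU : ((d 0%N).2%:R + v : Zp) \is a GRing.unit.
  rewrite padic_int_unitE; apply/negP => /eqP E.
  have [z vE] := padic_int_divp E.
  move: bv1; rewrite -(rmorph_nat (@padic_inj R p p_pr)) -rmorphD vE.
  rewrite padic_abs_pexpM => H; have : p%:R ^- 1 < 1 :> R by rewrite invf_lt1.
  apply/negP; rewrite -leNgt -[leLHS]H.
  by rewrite ler_piMr ?padic_abs_inj // invr_ge0 exprn_ge0 // ltW.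
rewrite rmorphM rmorphXn rmorph_nat rmorphV //.
by rewrite rmorphD rmorph_nat.
Qed.

(** Successive convergents agree to one more power of [p] at each step, because the
    inverse branches contract; so they have a limit [x e], which depends on the digit
    sequence [e] and satisfies the recursion [x e = p^a / (b + x e')] with [e'] the
    shifted sequence.  By [schneider_inv] the Schneider map acts on these limits as
    the shift. *)
Lemma exists_digits d : valid_digits d -> exists2 x, infinite_expansion x &
  forall n, digit (iter n T x) = d n.
Proof.
have conv_succ n : forall d, valid_digits d ->
    padic_abs (padic_inj R (convergent d n - convergent d n.+1)) <= p%:R ^- n.
  elim: n => [|n IH] e ev; first by rewrite expr0 invr1 padic_abs_inj.
  have ev' : valid_digits (fun i => e i.+1) by move=> i; exact: ev.
  have [a0 b0p] := ev 0%N.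
  have -> : padic_inj R (convergent e n.+1 - convergent e n.+2) =
      padic_inj R (convergent e n.+1) - padic_inj R (convergent e n.+2).
    exact: rmorphB.
  rewrite (convergentS n ev) (convergentS n.+1 ev).
  rewrite (mobius_dist _ b0p (convergent_pZp n ev') (convergent_pZp n.+1 ev')).
  rewrite -(rmorphB (@padic_inj R p p_pr)) exprS invfM -exprnN.
  rewrite ler_pM ?IH ?padic_abs_ge0 //.
  by rewrite lef_pV2 ?posrE ?exprn_gt0 // -[leLHS]expr1 ler_eXn2l.
have lim (e : nat -> nat * nat) : exists X : Zp, valid_digits e -> forall n,
    padic_abs (padic_inj R (X - convergent e n)) <= p%:R ^- n.
  have [ev|nev] := pselect (valid_digits e); last by exists 0.
  have [X XP] := @padic_int_complete (convergent e) (fun n => conv_succ n e ev).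
  by exists X.
have [X XP] := choice lim; pose x e := padic_inj R (X e).
have x1 e : valid_digits e -> pZp R p_pr (x e).
  move=> ev; rewrite /pZp /= /x -[X e](subrK (convergent e 1%N)) rmorphD.
  apply: le_lt_trans (padic_abs_ultra _ _) _; rewrite gt_max.
  apply/andP; split; last exact: convergent_pZp.
  by apply: le_lt_trans (XP e ev 1%N) _; rewrite invf_lt1.
have xE e : valid_digits e -> x e =
    p%:R ^ (e 0%N).1%:Z / ((e 0%N).2%:R + x (fun i => e i.+1)).
  move=> ev; have ev' : valid_digits (fun i => e i.+1) by move=> i; exact: ev.
  have [a0 b0p] := ev 0%N.
  apply: padic_dist_eq0; apply/eqP; rewrite eq_le padic_abs_ge0 andbT.
  apply/ler_addgt0Pr => eps eps0; rewrite add0r.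
  have pV01 : 0 < (p%:R^-1 : R) < 1 by rewrite invr_gt0 p0 invf_lt1.
  (* Both sides are within [p^-n] of the convergent of length [n + 1]. *)
  have [n /(_ n (leqnn n))] := exprn_small pV01 eps0.
  rewrite exprVn; apply: le_trans.
  rewrite -[x e](subrK (padic_inj R (convergent e n.+1))) -addrA.
  apply: le_trans (padic_abs_ultra _ _) _; rewrite ge_max.
  have pn : p%:R ^- n.+1 <= p%:R ^- n :> R.
    by rewrite lef_pV2 ?posrE ?exprn_gt0 // ler_eXn2l.
  rewrite {1}/x -rmorphB (le_trans (XP e ev n.+1)) //=.
  rewrite (convergentS n ev).
  rewrite (mobius_dist _ b0p (convergent_pZp n ev') (x1 _ ev')).
  rewrite padic_dist_sym /x -(rmorphB (@padic_inj R p p_pr)).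
  apply: le_trans (XP _ ev' n).
  rewrite ler_piMl ?padic_abs_ge0 // -exprnN invf_le1 ?exprn_gt0 //.
  by rewrite exprn_ege1 // ltW.
move=> dv.
have tailv k : valid_digits (fun i => d (k + i)%N) by move=> i; exact: dv.
have orbit k : iter k T (x d) = x (fun i => d (k + i)%N).
  elim: k => [//|k IH]; rewrite iterS IH.
  have [//|] := schneider_inv (tailv k 0%N).2 _ (xE _ (tailv k)).
    by apply: x1 => i; exact: dv.
  move=> _ _ _ ->; congr x; apply/funext => i; by rewrite addSnnS.
have dig k : x (fun i => d (k + i)%N) != 0 /\
    digit (x (fun i => d (k + i)%N)) = d k.
  have [|n0 ea eb _] := schneider_inv (tailv k 0%N).2 _ (xE _ (tailv k)).
    by apply: x1 => i; exact: dv.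
  split=> //; rewrite /digit ea eb addn0 absz_nat; by case: (d k).
exists (x d).
  split; first exact: x1.
  by move=> [_ [k]]; rewrite orbit => /eqP; apply/negP; case: (dig k).
by move=> n; rewrite orbit; case: (dig n).
Qed.
End SchneiderExistence.

(** * Sums over words *)

Section WordSums.
Variables (R : realType) (A : eqType) (m : A -> R).
Hypothesis m_ge0 : forall d, 0 <= m d.
Implicit Types (w : seq A) (ws : seq (seq A)).

Definition word_mass w : R := \prod_(d <- w) m d.

Lemma word_mass_ge0 w : 0 <= word_mass w.
Proof. by apply: prodr_ge0 => d _. Qed.

Lemma ler_sum_uniq_sub (I : eqType) (f : I -> R) (s s' : seq I) :
  (forall i, 0 <= f i) -> uniq s -> uniq s' -> {subset s <= s'} ->
  \sum_(i <- s) f i <= \sum_(i <- s') f i.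
Proof.
move=> f0 us us' ss'.
have -> : \sum_(i <- s) f i = \sum_(i <- s' | i \in s) f i.
  rewrite -[RHS]big_filter; apply/perm_big/uniq_perm => //.
    exact: filter_uniq.
  move=> i; rewrite mem_filter; case is_ : (i \in s) => //=.
  by rewrite (ss' _ is_).
by rewrite big_mkcond; apply: ler_sum => i _; case: ifP.
Qed.

Lemma sum_word_mass_size (D : seq A) n ws : uniq D -> uniq ws ->
  {in ws, forall w, size w = n /\ {subset w <= D}} ->
  \sum_(w <- ws) word_mass w <= (\sum_(d <- D) m d) ^+ n.
Proof.
move=> uD uws wsP.
pose all_words n := iter n (fun us => [seq d :: w | d <- D, w <- us]) [:: [::]].
have all_uniq k : uniq (all_words k).
  elim: k => //= k IH; apply: allpairs_uniq => //.
  by move=> [a u] [b v] _ _ /= [-> ->].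
have all_sum k : \sum_(w <- all_words k) word_mass w = (\sum_(d <- D) m d) ^+ k.
  elim: k => [|k IH]; first by rewrite big_seq1 /word_mass big_nil expr0.
  rewrite /= big_allpairs_dep exprS -IH big_distrl /=.
  apply: eq_bigr => d _; rewrite big_distrr /=; apply: eq_bigr => w _.
  by rewrite /word_mass big_cons.
have all_mem w k : size w = k -> {subset w <= D} -> w \in all_words k.
  elim: w k => [|d w IH] [|k] //= [sw] wD; apply: allpairs_f.
    by apply: wD; rewrite mem_head.
  by apply: IH => // e ew; apply: wD; rewrite in_cons ew orbT.
rewrite -all_sum; apply: ler_sum_uniq_sub => //; first exact: word_mass_ge0.
by move=> w /wsP[sw wD]; apply: all_mem.
Qed.

(** Words of each length have total mass at most 1, whence a geometric series in
    the length, starting at the minimal length [M]. *)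
Lemma sum_word_mass_geometric (D : seq A) (q : R) M ws :
  uniq D -> \sum_(d <- D) m d <= 1 -> 0 < q < 1 -> uniq ws ->
  {in ws, forall w, (M <= size w)%N /\ {subset w <= D}} ->
  \sum_(w <- ws) q ^+ size w * word_mass w <= q ^+ M / (1 - q).
Proof.
move=> uD D1 /andP[q0 q1] uws wsP.
pose L := (\max_(w <- ws) size w).+1.
have sizeL w : w \in ws -> (size w < L)%N by move=> wws; rewrite ltnS leq_bigmax_seq.
have -> : \sum_(w <- ws) q ^+ size w * word_mass w =
    \sum_(M <= n < M + L) q ^+ n * \sum_(w <- ws | size w == n) word_mass w.
  under [RHS]eq_bigr do rewrite big_distrr big_mkcond /=.
  rewrite exchange_big /=; apply: eq_big_seq => w wws.
  rewrite (bigD1_seq (size w)) ?iota_uniq //=; last first.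
    by rewrite mem_index_iota (wsP _ wws).1 (leq_trans (sizeL _ wws)) // leq_addl.
  rewrite eqxx big1 ?addr0 // => i; rewrite eq_sym => /negPf -> //.
apply: (@le_trans _ _ (\sum_(M <= n < M + L) q ^+ n)).
  apply: ler_sum => n _; rewrite ler_piMr ?exprn_ge0 ?(ltW q0) //.
  rewrite -big_filter; apply: le_trans (sum_word_mass_size (n := n) uD _ _) _.
  - exact: filter_uniq.
  - by move=> w; rewrite mem_filter => /andP[/eqP sw /wsP[]].
  - by rewrite exprn_ile1 // sumr_ge0.
rewrite geometric_partial_tail; apply: geometric_le_lim => //.
  by rewrite exprn_ge0 // ltW.
by rewrite ger0_norm // ltW.
Qed.

End WordSums.

Lemma nneseries_le_partial (R : realType) (u : nat -> \bar R) (b : \bar R) :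
  (forall i, (0 <= u i)%E) -> (forall n, (\sum_(0 <= i < n) u i <= b)%E) ->
  (\sum_(0 <= i <oo) u i <= b)%E.
Proof.
move=> u0 ub; apply: lime_le; first exact: is_cvg_nneseries.
by near do exact: ub.
Unshelve. all: by end_near. Qed.

(** Families indexed by a countable type are enumerated by [pickle_inv], where
    indices that code nothing contribute 0. *)
Lemma nneseries_pickle_le (R : realType) (I : countType) (f : I -> R) (b : R) :
  (forall i, 0 <= f i) ->
  (forall s : seq I, uniq s -> \sum_(i <- s) f i <= b) ->
  (\sum_(0 <= n <oo) (oapp f 0 (pickle_inv n))%:E <= b%:E)%E.
Proof.
move=> f0 fb; apply: nneseries_le_partial => [n|n].
  by rewrite lee_fin; case: pickle_inv.
rewrite sumEFin lee_fin -big_pmap; apply: fb.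
by rewrite (pmap_uniq (@pickle_invK I)) // iota_uniq.
Qed.

(** Law of a digit [(a, b)] with [b] uniform on [p - 1] values and [a]
    geometric of ratio [r]. *)
Definition digit_mass (R : realType) (r : R) (p : nat) (d : nat * nat) : R :=
  (1 - r) * r ^+ d.1.-1 / (p%:R - 1).

Lemma geometric_digit_sum (R : realType) (r : R) (p N : nat) :
  0 < r < 1 -> (1 < p)%N ->
  \sum_(d <- [seq (a, b) | a <- iota 1 N, b <- iota 1 p.-1])
    digit_mass r p d <= 1.
Proof.
move=> /andP[r0 r1] p1; rewrite big_allpairs_dep /digit_mass /=.
have p10 : p%:R - 1 = p.-1%:R :> R by rewrite -subn1 natrB // ltnW.
under eq_bigr => a _.
  rewrite big_const_seq count_predT size_iota iter_addr addr0 p10.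
  rewrite -[_ *+ _]mulr_natr divfK; last by rewrite pnatr_eq0 -lt0n -ltnS prednK // ltnW.
  over.
rewrite -[1%N]/(1 + 0)%N iotaDl big_map -mulr_sumr /=.
have -> : \sum_(j <- iota 0 N) r ^+ (0 + j) = \sum_(j < N) r ^+ j.
  by rewrite -(big_mkord xpredT (fun j => r ^+ j)) /index_iota subn0.
have := subrX1 r N => H.
have -> : (1 - r) * (\sum_(j < N) r ^+ j) = 1 - r ^+ N.
  by rewrite -[1 - r]opprB mulNr -H opprB.
by rewrite gerBl exprn_ge0 // ltW.
Qed.

(** Exponential growth rate in [n] of the number of compositions of [t n] into [n]
    positive parts.  As [ln 0 = 0], it takes the right value 0 at [t = 1]. *)
Definition entropy (R : realType) (t : R) : R :=
  t * ln t - (t - 1) * ln (t - 1).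

Lemma entropy1 (R : realType) : entropy (1 : R) = 0.
Proof. by rewrite /entropy subrr ln1 mulr0 mul0r subrr. Qed.

(** The ratio [r = (t-1)/t], which gives the geometric law mean [t], reaches the
    entropy exactly.  At [t = 1] it degenerates to 0, and a small positive [r] loses
    only [e]. *)
Lemma geometric_entropy (R : realType) (t e : R) : 1 <= t -> 0 < e ->
  exists2 r, 0 < r < 1 & - ln (1 - r) - (t - 1) * ln r <= entropy t + e.
Proof.
rewrite le_eqVlt => /orP[/eqP<-|t1] e0.
  exists (1 - expR (- e)).
    by rewrite subr_gt0 expR_lt1 oppr_lt0 e0 gtrBl expR_gt0.
  by rewrite entropy1 subKr expRK subrr mul0r opprK subr0 add0r.
have t0 : 0 < t by apply: lt_trans t1.
exists ((t - 1) / t).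
  by rewrite divr_gt0 ?subr_gt0 //= ltr_pdivrMr // mul1r gtrBl.
have -> : 1 - (t - 1) / t = t^-1 by field; rewrite gt_eqF.
rewrite ln_div ?posrE ?subr_gt0 // lnV ?posrE // /entropy.
by rewrite (_ : _ - _ = t * ln t - (t - 1) * ln (t - 1)) ?lerDl ?ltW //; ring.
Qed.

Lemma entropy_ge0 (R : realType) (t : R) : 1 <= t -> 0 <= entropy t.
Proof.
move=> t1; apply/ler_addgt0Pr => e e0.
have [r /andP[r0 r1]] := geometric_entropy t1 e0; apply: le_trans.
rewrite subr_ge0 (@le_trans _ _ 0) //.
  by rewrite mulr_ge0_le0 ?subr_ge0 // ln_le0 // ltW.
by rewrite oppr_ge0 ln_le0 // gerBl ltW.
Qed.

(** The left-hand side is [ln (p^(- s S))] and the bracket on the right is the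
    logarithm of the mass of a word of length [n] and weight [S], with
    [L = ln p] and [K = ln (p-1)].  At [S = t n] the inequality holds with room
    [g n], where [g] is the gap in the hypothesis; the room is shared between the loss
    in [geometric_entropy], the rate [c], and the deviation of [S] from [t n]. *)
Lemma covering_rate (R : realType) (s t K L : R) : 1 <= t -> 0 <= s -> 0 < L ->
  K + entropy t < s * (t * L) ->
  exists r c e, [/\ 0 < r < 1, 0 < c, 0 < e & forall n S : R, 0 <= n ->
    `|S - t * n| <= e * n ->
    - (s * (S * L)) <= - (c * n) + (n * ln (1 - r) + (S - n) * ln r - n * K)].
Proof.
move=> t1 s0 L0 gap; pose g := s * (t * L) - (K + entropy t).
have g0 : 0 < g by rewrite subr_gt0.
have [|r r01 Hr] := @geometric_entropy R t (g / 4) t1; first by rewrite divr_gt0.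
have /andP[r0 r1] := r01.
have lr : 0 <= - ln r by rewrite oppr_ge0 ln_le0 // ltW.
pose B := - ln r + s * L + 1.
have B0 : 0 < B by rewrite ltr_wpDl // addr_ge0 // mulr_ge0 // ltW.
pose e := g / 4 / B; have e0 : 0 < e by rewrite !divr_gt0.
have eB : e * (- ln r + s * L) <= g / 4.
  have <- : e * B = g / 4 by rewrite divfK // gt_eqF.
  by rewrite ler_wpM2l ?lerDl // ltW.
exists r, (g / 4), e; split; rewrite ?divr_gt0 // => n S n0.
rewrite ler_norml => /andP[Sl Su].
have H1 : 0 <= (t * n + e * n - S) * (- ln r) by rewrite mulr_ge0 //; move: Su; lra.
have H2 : 0 <= (S - t * n + e * n) * (s * L).
  by rewrite !mulr_ge0 ?(ltW L0) //; move: Sl; lra.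
have H3 : 0 <= n * (g / 4 - e * (- ln r + s * L)).
  by rewrite mulr_ge0 // subr_ge0.
have H4 : 0 <= n * (entropy t + g / 4 - (- ln (1 - r) - (t - 1) * ln r)).
  by rewrite mulr_ge0 // subr_ge0.
have H5 : 0 <= n * g by rewrite mulr_ge0 // ltW.
have gE : n * g = n * (s * (t * L)) - n * (K + entropy t) by rewrite /g; ring.
move: H1 H2 H3 H4 H5 gE; clear; move: (entropy t) (ln r) (ln (1 - r)) => h l a.
lra.
Qed.

(** * Covering the level sets *)

Section LevelSets.
Variables (R : realType) (p : nat) (p_pr : prime p).
Local Notation Qp := (padic R p_pr).
Local Notation T := (@schneider R p p_pr).
Implicit Types (x y : Qp) (w : seq (nat * nat)).

Let p0 : 0 < p%:R :> R. Proof. by rewrite ltr0n prime_gt0. Qed.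
Let p1 : 1 < p%:R :> R. Proof. by rewrite ltr1n prime_gt1. Qed.
Let p10 : 0 < p%:R - 1 :> R. Proof. by rewrite subr_gt0. Qed.
Let lnp0 : 0 < ln p%:R :> R. Proof. by rewrite ln_gt0. Qed.

Lemma lyapunov_avgE x n : infinite_expansion x ->
  lyapunov_avg x n = ln p%:R * ((weight (digit_word x n))%:R / n%:R).
Proof.
move=> xi; rewrite /lyapunov_avg mulrC mulrA; congr (_ / _).
rewrite /weight /digit_word big_map natr_sum mulr_sumr /index_iota subn0.
apply: eq_bigr => k _; have xk := infinite_expansion_iter k xi.
by rewrite /schneider_psi (digit_a xk) lnXn // mulr_natr.
Qed.

Lemma lyapunov_levelP x alpha : lyapunov_level p_pr alpha x <->
  infinite_expansion x /\
  (weight (digit_word x n))%:R / n%:R @[n --> \oo] --> alpha / ln p%:R.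
Proof.
have L0 : ln p%:R != 0 :> R by rewrite gt_eqF.
split=> [[x1 xF xc xa]|[xi xl]].
  have xi : infinite_expansion x by [].
  split=> //; have xl : lyapunov_avg x n @[n --> \oo] --> alpha.
    by rewrite -xa; exact: xc.
  apply: cvg_trans (cvgM xl (cvg_cst (ln p%:R)^-1)); apply: near_eq_cvg.
  by near=> n; rewrite /= lyapunov_avgE // mulrAC mulfV // mul1r.
have xl' : lyapunov_avg x n @[n --> \oo] --> alpha.
  rewrite -[alpha](divfK L0).
  apply: cvg_trans (cvgM xl (cvg_cst (ln p%:R))); apply: near_eq_cvg.
  by near=> n; rewrite /= lyapunov_avgE // mulrC.
case: xi => x1 xF; split=> //; first by apply/cvg_ex; exists alpha.
exact: cvg_lim xl'.
Unshelve. all: by end_near. Qed.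

Definition valid_word w := all (fun d => (0 < d.1)%N && (0 < d.2 < p)%N) w.

Lemma digit_word_valid x n : infinite_expansion x ->
  valid_word (digit_word x n).
Proof.
move=> xi; apply/allP => d /mapP[k _ ->].
by have [-> ->] := digit_valid (infinite_expansion_iter k xi).
Qed.

Lemma valid_word_size w : valid_word w -> (size w <= weight w)%N.
Proof.
elim: w => //= d w IH /andP[/andP[d0 _] /IH sw].
by rewrite weight_cons -add1n leq_add.
Qed.

Lemma word_mass_expR (r : R) w : 0 < r < 1 -> valid_word w ->
  word_mass (digit_mass r p) w =
  expR ((size w)%:R * ln (1 - r) + ((weight w)%:R - (size w)%:R) * ln r
        - (size w)%:R * ln (p%:R - 1)).
Proof.
move=> /andP[r0 r1]; elim: w => [_|d w IH /= /andP[/andP[d0 _] /IH wE]].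
  by rewrite /word_mass /weight !big_nil /= !mul0r subrr mul0r addr0 subr0 expR0.
rewrite /word_mass big_cons -/(word_mass _ w) wE weight_cons /digit_mass.
rewrite -(prednK d0) /= -[1 - r]lnK ?posrE ?subr_gt0 //.
rewrite -[r in r ^+ _]lnK ?posrE // -[p%:R - 1]lnK ?posrE //.
rewrite -expRM_natl -expRN -!expRD !lnK ?posrE ?subr_gt0 //; congr expR.
rewrite -!natr1 natrD; ring.
Qed.

Definition cylinder w : set Qp :=
  [set x | infinite_expansion x /\ digit_word x (size w) = w].

Lemma diameter_cylinder w :
  (diameter (cylinder w) <= (p%:R ^- weight w : R)%:E)%E.
Proof.
apply: diameter_le => x y [xi xw] [yi yw]; rewrite padic_mdistE.
have := @digit_word_dist R p p_pr (size w) x y xi yi.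
by rewrite xw yw; apply.
Qed.

(** The cover consists of all cylinders of length at least [M] whose average weight
    is within [e] of [t]: a point of the level set lies in infinitely many of them.
    By [covering_rate] their [s]-sum is bounded by the geometric tail
    [q^M / (1 - q)] with [q = exp (- c)]. *)
Lemma level_measure_eq0 (alpha s : R) : ln p%:R <= alpha -> 0 <= s ->
  ln (p%:R - 1) + entropy (alpha / ln p%:R) < s * alpha ->
  hausdorff_measure s (lyapunov_level p_pr alpha) = 0%E.
Proof.
move=> alpha1 s0 gap; set t := alpha / ln p%:R in gap.
have t1 : 1 <= t by rewrite ler_pdivlMr // mul1r.
have tL : t * ln p%:R = alpha by rewrite divfK // gt_eqF.
rewrite -tL in gap; have [r [c [e [r01 c0 e0 rate]]]] := covering_rate t1 s0 lnp0 gap.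
apply: hausdorff_measure_eq0 => d eta d0 eta0.
pose q := expR (- c); have q0 : 0 < q := expR_gt0 _.
have q1 : q < 1 by rewrite expR_lt1 oppr_lt0.
have q01 : 0 < q < 1 by rewrite q0.
have pV01 : 0 < (p%:R^-1 : R) < 1 by rewrite invr_gt0 p0 invf_lt1.
have [|M1 HM1] := exprn_small q01 (e := eta * (1 - q)).
  by rewrite mulr_gt0 // subr_gt0.
have [M2 HM2] := exprn_small pV01 d0.
pose M := maxn M1 M2.
pose good w := [&& valid_word w, (M <= size w)%N &
  `|(weight w)%:R - t * (size w)%:R| <= e * (size w)%:R].
pose f w := if good w then q ^+ size w * word_mass (digit_mass r p) w else 0.
pose U i := if pickle_inv i is Some w then
  (if good w then cylinder w else set0) else set0.
have mass0 dg : 0 <= digit_mass r p dg.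
  have /andP[r0 r1] := r01.
  by rewrite divr_ge0 ?mulr_ge0 ?exprn_ge0 ?subr_ge0 // ltW.
have f0 w : 0 <= f w.
  rewrite /f; case: ifP => // _; rewrite mulr_ge0 ?exprn_ge0 ?(ltW q0) //.
  exact: word_mass_ge0.
have diam0 (b : \bar R) : (0 <= b)%E -> (@diameter R Qp set0 <= b)%E.
  move=> b0; apply: le_trans b0; apply: diameter_le => x y [].
exists U; split.
- move=> i; rewrite /U; case: pickle_inv => [w|]; last by rewrite diam0 // lee_fin ltW.
  case: ifP => [/and3P[vw Mw _]|_]; last by rewrite diam0 // lee_fin ltW.
  apply: le_trans (diameter_cylinder w) _; rewrite lee_fin -exprVn HM2 //.
  by apply: leq_trans (valid_word_size vw); apply: leq_trans Mw; exact: leq_maxr.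
- move=> x /lyapunov_levelP[xi xl].
  have [n nM nx] : exists2 n : nat, (M < n)%N &
      `|(weight (digit_word x n))%:R / n%:R - t| <= e.
    move/cvgrPdist_le : xl => /(_ _ e0)[N _ HN].
    exists (maxn N M.+1); first exact: leq_maxr.
    by rewrite distrC; apply: HN; exact: leq_maxl.
  exists (pickle (digit_word x n)) => //; rewrite /U pickleK_inv.
  have n0 : 0 < n%:R :> R by rewrite ltr0n (leq_trans _ nM).
  have -> : good (digit_word x n).
    rewrite /good digit_word_valid // size_digit_word ltnW //=.
    rewrite -ler_pdivrMr // -[X in _ / X]ger0_norm ?(ltW n0) // -normf_div.
    by rewrite mulrBl mulfK // gt_eqF.
  by split=> //; rewrite size_digit_word.
apply: (@le_trans _ _ (\sum_(0 <= i <oo) (oapp f 0 (pickle_inv i))%:E)%E).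
  apply: lee_nneseries => i _; first by move=> _; exact: hausdorff_weight_ge0.
  rewrite /U; case: pickle_inv => [w|] /=; last by rewrite /hausdorff_weight eqxx.
  rewrite /f; case: ifP => [/and3P[vw Mw tw]|_]; last first.
    by rewrite /hausdorff_weight eqxx.
  apply: le_trans (hausdorff_weight_le s0 _ (diameter_cylinder w)) _.
    by rewrite invr_ge0 exprn_ge0 // ltW.
  rewrite lee_fin word_mass_expR // /q -expRM_natl -expRD.
  rewrite /powR gt_eqF ?invr_gt0 ?exprn_gt0 // lnV ?posrE ?exprn_gt0 // lnXn //.
  rewrite ler_expR -(mulr_natl (ln _)).
  by have := rate (size w)%:R (weight w)%:R (ler0n _ _) tw; lra.
apply: nneseries_pickle_le => // ws uws.
apply: (@le_trans _ _ (q ^+ M / (1 - q))); last first.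
  by rewrite ler_pdivrMr ?subr_gt0 // HM1 // leq_maxl.
rewrite /f -big_mkcond -big_filter.
(* Finitely many words use finitely many digits, and [N] bounds them. *)
pose N := \max_(w <- ws) weight w.
apply: (@sum_word_mass_geometric R _ _ mass0
  [seq (a, b) | a <- iota 1 N, b <- iota 1 p.-1]) => //.
- apply: allpairs_uniq; rewrite ?iota_uniq //.
  by move=> [? ?] [? ?] _ _ /= [-> ->].
- by apply: geometric_digit_sum => //; exact: prime_gt1.
- exact: filter_uniq.
- move=> w; rewrite mem_filter => /andP[/and3P[vw Mw _] wws]; split=> // dg dw.
  have /andP[a0 /andP[b0 bp]] := allP vw dg dw.
  rewrite [dg]surjective_pairing; apply: allpairs_f; rewrite mem_iota.
    rewrite a0 /= add1n ltnS (@leq_trans (weight w)) //.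
      by rewrite /weight (big_rem dg) //= leq_addr.
    exact: leq_bigmax_seq.
  by rewrite b0 /= add1n prednK // prime_gt0.
Qed.

End LevelSets.

(** * Counting compositions *)

Section CompositionEntropy.
Variable R : realType.

(** Weak Stirling bounds, by induction from
    [1/(n+1) <= ln (n+1) - ln n <= 1/n]; the polynomial error is harmless here. *)
Lemma ln_fact_bounds n : (0 < n)%N ->
  n%:R * ln n%:R - n%:R <= ln (n`!%:R) :> R /\
  ln (n`!%:R) <= n%:R * ln n%:R - n%:R + ln n%:R + 1 :> R.
Proof.
case: n => // n _; elim: n => [|n [IHl IHu]].
  by rewrite factS fact0 muln1 ln1 mulr0 sub0r; split; lra.
set k := n.+1 in IHl IHu *; have k0 : 0 < k%:R :> R by rewrite ltr0n.
have k10 : 0 < k.+1%:R :> R by rewrite ltr0n.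
rewrite factS natrM lnM ?posrE ?ltr0n ?fact_gt0 //.
have up : k%:R * (ln k.+1%:R - ln k%:R) <= 1 :> R.
  rewrite -ln_div ?posrE // -ler_pdivlMl // mulr1.
  have -> : k.+1%:R / k%:R = 1 + k%:R^-1 :> R.
    by rewrite -natr1; field; rewrite gt_eqF.
  by apply: le_ln1Dx; rewrite (lt_trans (ltrN10 _)) // invr_gt0.
have low : 1 <= k.+1%:R * (ln k.+1%:R - ln k%:R) :> R.
  rewrite -ler_pdivrMl // mulr1 -lerN2 opprB -ln_div ?posrE //.
  have -> : k%:R / k.+1%:R = 1 + - k.+1%:R^-1 :> R.
    by rewrite -natr1; field; rewrite natr1 gt_eqF.
  by apply: le_ln1Dx; rewrite ltrN2 invf_lt1 // ltr1n.
rewrite -natr1 in up low *; split; lra.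
Qed.

Lemma ln_le_linear (d x : R) : 0 < d -> 0 < x -> ln x <= d * x - ln d.
Proof.
move=> d0 x0; rewrite lerBrDr -lnM ?posrE // mulrC.
have dx0 := mulr_gt0 d0 x0.
have : ln (1 + (d * x - 1)) <= d * x - 1 by apply: le_ln1Dx; lra.
by rewrite subrKC => /le_trans; apply; rewrite gerBl.
Qed.

(** The linear terms of the Stirling bounds cancel, and what remains of
    [(m+n) ln (m+n) - m ln m - n ln n] is homogeneous of degree 1, up to
    logarithmic errors. *)
Lemma ln_binomial_ge m n : (0 < m)%N -> (0 < n)%N ->
  m%:R * entropy (1 + n%:R / m%:R) - ln m%:R - ln n%:R - 2 <=
  ln 'C(m + n, m)%:R :> R.
Proof.
move=> m0 n0; have m0' : 0 < m%:R :> R by rewrite ltr0n.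
have n0' : 0 < n%:R :> R by rewrite ltr0n.
have [fl _] := ln_fact_bounds (ltn_addr n m0).
have [_ fm] := ln_fact_bounds m0; have [_ fn] := ln_fact_bounds n0.
have binE : ln 'C(m + n, m)%:R = ln ((m + n)`!%:R) - ln (m`!%:R) - ln (n`!%:R) :> R.
  rewrite -(bin_fact (leq_addr n m)) addKn !natrM.
  rewrite !lnM ?posrE ?mulr_gt0 ?ltr0n ?fact_gt0 ?bin_gt0 ?leq_addr //; ring.
rewrite binE /entropy [1 + _]addrC addrK.
have -> : n%:R / m%:R + 1 = (m + n)%:R / m%:R :> R.
  by rewrite natrD; field; rewrite gt_eqF.
rewrite !ln_div ?posrE ?ltr0n ?addn_gt0 ?m0 //.
have -> : m%:R * ((m + n)%:R / m%:R * (ln (m + n)%:R - ln m%:R) -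
   n%:R / m%:R * (ln n%:R - ln m%:R)) =
   (m + n)%:R * (ln (m + n)%:R - ln m%:R) - n%:R * (ln n%:R - ln m%:R) :> R.
  by field; rewrite gt_eqF.
move: fl fm fn; rewrite natrD; lra.
Qed.

Lemma entropy_continuous (t e : R) : 1 < t -> 0 < e ->
  exists2 d, 0 < d & forall v, `|v - t| < d -> entropy t - e <= entropy v.
Proof.
move=> t1 e0; have t0 : 0 < t by apply: lt_trans t1.
have : {for t, continuous (@entropy R)}.
  apply: cvgB.
    by apply: cvgM; [exact: cvg_id | apply: continuous_ln].
  apply: cvgM; first by apply: cvgB; [exact: cvg_id | exact: cvg_cst].
  apply: (@continuous_comp _ _ _ (fun x : R => x - 1) (@ln R)).
    by apply: cvgB; [exact: cvg_id | exact: cvg_cst].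
  by apply: continuous_ln; rewrite subr_gt0.
move=> /cvgrPdist_le /(_ _ e0) /nbhs_ballP[d /= d0 dP]; exists d => // v vt.
have := dP v; rewrite /ball /= distrC => /(_ vt).
rewrite ler_norml => /andP[_]; lra.
Qed.

(** A block of length [m + 1] has weight [floor (t (m + 1))]; this is what is left
    once every part has received the minimal value 1. *)
Definition excess (t : R) m : nat := (Num.truncn (t * m.+1%:R) - m.+1)%N.

(** With [n] the excess, [1 + n/m --> t] as [m] grows, so [ln_binomial_ge] and the
    continuity of the entropy conclude for [t > 1].  At [t = 1] the entropy is 0 and the
    left-hand side is negative for every [m]. *)
Lemma composition_entropy (t e : R) : 1 <= t -> 0 < e ->
  exists m, m.+1%:R * (entropy t - e) <= ln 'C(m + excess t m, m)%:R.
Proof.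
rewrite le_eqVlt => /orP[/eqP <-|t1] e0.
  exists 0%N; rewrite bin0 ln1 entropy1 mul1r; lra.
have e0' : 0 < e / 3 by rewrite divr_gt0.
have [d d0 dP] := entropy_continuous t1 e0'.
pose C := - ln (e / 6) *+ 2 + ln t + 2.
pose B := `|entropy t - e| + `|C|.
have t0 : 0 < t by apply: lt_trans t1.
have td0 : 0 < t / d by rewrite divr_gt0.
have tu0 : 0 < 2 / (t - 1) by rewrite divr_gt0 ?subr_gt0.
have B0 : 0 <= 3 / e * B by rewrite mulr_ge0 ?addr_ge0 // divr_ge0 // ltW.
(* Each summand of [X] serves one of the lower bounds on [m] that follow. *)
pose X := t + t / d + 2 / (t - 1) + 3 / e * B.
pose m := (Num.truncn X).+1; exists m.
have mX : X < m%:R by exact: truncnS_gt.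
have m0 : 0 < m%:R :> R by rewrite ltr0n.
have mt : t < m%:R by move: mX; rewrite /X; lra.
have md : t < d * m%:R.
  by rewrite mulrC -ltr_pdivrMr //; move: mX; rewrite /X; lra.
have mu : 2 < (t - 1) * m%:R.
  by rewrite mulrC -ltr_pdivrMr ?subr_gt0 //; move: mX; rewrite /X; lra.
have mB : B < e / 3 * m%:R.
  have -> : B = e / 3 * (3 / e * B) by field; rewrite gt_eqF.
  by rewrite ltr_pM2l //; move: mX; rewrite /X; lra.
have kE : m.+1%:R = m%:R + 1 :> R by rewrite natr1.
have tk0 : 0 <= t * m.+1%:R by rewrite mulr_ge0 // ltW.
have /andP[trl tru] := truncn_itv tk0.
have ktr : (m.+1 <= Num.truncn (t * m.+1%:R))%N.
  by rewrite truncn_ge_nat // ler_peMl // ltW.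
have nE : (excess t m)%:R = (Num.truncn (t * m.+1%:R))%:R - m.+1%:R :> R.
  by rewrite /excess natrB.
set n := excess t m in nE *.
rewrite -[ltRHS]natr1 in tru.
have nu : n%:R <= t * m.+1%:R - m.+1%:R by rewrite nE lerD2r.
have nl : t * m.+1%:R - m.+1%:R - 1 < n%:R by rewrite nE; lra.
rewrite kE in nu nl *.
have n0' : 0 < n%:R :> R by move: nl mu t1; lra.
have n0 : (0 < n)%N by rewrite -(ltr0n R).
apply: le_trans (ln_binomial_ge _ n0) => //.
have vt : entropy t - e / 3 <= entropy (1 + n%:R / m%:R).
  apply: dP; have -> : 1 + n%:R / m%:R - t = (n%:R - (t - 1) * m%:R) / m%:R.
    by field; rewrite gt_eqF.
  rewrite normf_div (gtr0_norm m0) ltr_pdivrMr // ltr_norml.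
  by apply/andP; split; move: nl nu md t1; lra.
have lnm : ln m%:R <= e / 6 * m%:R - ln (e / 6).
  by apply: ln_le_linear; rewrite ?divr_gt0.
have lnn : ln n%:R <= ln t + ln m%:R.
  rewrite -lnM ?posrE // ler_ln ?posrE ?mulr_gt0 //.
  by move: nu mt; lra.
have mv : m%:R * (entropy t - e / 3) <= m%:R * entropy (1 + n%:R / m%:R).
  by rewrite ler_pM2l.
have Bl : entropy t - e + C <= B by rewrite /B lerD // ler_norm.
move: mv Bl lnm lnn mB; rewrite /C; lra.
Qed.
End CompositionEntropy.

(** * A homogeneous tree inside a level set *)

Lemma sum_nat_split (F : nat -> nat) a b : (a <= b)%N ->
  (\sum_(0 <= i < b) F i = \sum_(0 <= i < a) F i + \sum_(i < b - a) F (a + i))%N.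
Proof.
move=> ab; rewrite (big_cat_nat (n := a)) //=; congr (_ + _)%N.
rewrite -{1}[a]add0n big_addn big_mkord.
by apply: eq_bigr => i _; rewrite addnC.
Qed.

Section LowerBound.
Variables (R : realType) (p : nat) (p_pr : prime p) (t : R) (m : nat).
Hypothesis t1 : 1 <= t.
Local Notation Qp := (padic R p_pr).
Local Notation T := (@schneider R p p_pr).
Local Notation k := m.+1.
Local Notation n := (excess t m).

Let p0 : 0 < p%:R :> R. Proof. by rewrite ltr0n prime_gt0. Qed.
Let p1 : 1 < p%:R :> R. Proof. by rewrite ltr1n prime_gt1. Qed.
Let t0 : 0 < t. Proof. exact: lt_le_trans t1. Qed.

(** A composition of the excess into [m + 1] parts, together with free digits [b]. *)
Definition block : finType :=
  ({c : m.+1.-tuple 'I_n.+1 |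
     c \in [set c : m.+1.-tuple 'I_n.+1 | (\sum_(i <- c) i)%N == n]%SET} *
   m.+1.-tuple 'I_p.-1)%type.

Lemma card_block : #|{: block}| = ('C(m + n, m) * p.-1 ^ k)%N.
Proof. by rewrite card_prod card_sig card_ord_partitions card_tuple card_ord. Qed.

(** Weight reached after [q] blocks.  Since [t] may be irrational, it cannot be
    proportional to [q]. *)
Definition checkpoint q : nat := Num.truncn (t * (k * q)%:R).

Lemma checkpointP q : (checkpoint q)%:R <= t * (k * q)%:R < (checkpoint q)%:R + 1.
Proof.
by rewrite natr1; apply: truncn_itv; rewrite mulr_ge0 // ltW.
Qed.

(** Superadditivity of the floor: the last digit of a block only ever has to be
    enlarged. *)
Lemma checkpointS q : (k + n + checkpoint q <= checkpoint q.+1)%N.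
Proof.
have kn : (k + n)%:R <= t * k%:R.
  rewrite subnKC ?truncn_le ?mulr_ge0 ?(ltW t0) //.
  by rewrite truncn_ge_nat ?mulr_ge0 ?(ltW t0) // ler_peMl.
rewrite {2}/checkpoint truncn_ge_nat ?mulr_ge0 ?(ltW t0) //.
rewrite natrD mulnS (natrD _ k (k * q)) mulrDr.
by rewrite lerD //; case/andP: (checkpointP q).
Qed.

(** Parts and digits are stored shifted by 1.  The correction that brings the weight
    to the next checkpoint goes to the last digit and depends only on the position,
    so the block can still be decoded. *)
Definition block_digits (s : nat -> block) (i : nat) : nat * nat :=
  let w := s (i %/ k)%N in let j := inord (i %% k)%N in
  ((tnth (val w.1) j).+1 +
     (if j == ord_max then
        checkpoint (i %/ k).+1 - (k + n + checkpoint (i %/ k)) else 0),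
   (tnth w.2 j).+1)%N.

Lemma block_digitsE s q (j : 'I_k) : block_digits s (k * q + j) =
  ((tnth (val (s q).1) j).+1 +
     (if j == ord_max then checkpoint q.+1 - (k + n + checkpoint q) else 0),
   (tnth (s q).2 j).+1)%N.
Proof.
rewrite /block_digits mulnC divnMDl // divn_small // addn0 modnMDl modn_small //.
by rewrite inord_val.
Qed.

Lemma block_digits_valid s : valid_digits p (block_digits s).
Proof.
move=> i; split => //=; set c : 'I_p.-1 := tnth _ _.
by rewrite -[ltnRHS](prednK (prime_gt0 p_pr)) ltnS ltn_ord.
Qed.

Lemma block_digits_inj s u q :
  (forall i, (i < k * q)%N -> block_digits s i = block_digits u i) ->
  forall r, (r < q)%N -> s r = u r.
Proof.
move=> su r rq; have E (j : 'I_k) : block_digits s (k * r + j) = block_digits u (k * r + j).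
  apply: su; apply: (@leq_trans (k * r.+1)%N); last by rewrite leq_mul2l.
  by rewrite mulnS addnC ltn_add2r.
have cE : (s r).1 = (u r).1.
  apply/val_inj/eq_from_tnth => j; have := E j; rewrite !block_digitsE.
  by move=> /(congr1 fst) /eqP; rewrite /= eqn_add2r eqSS => /eqP/val_inj.
have bE : (s r).2 = (u r).2.
  apply/eq_from_tnth => j; have := E j; rewrite !block_digitsE.
  by move=> /(congr1 snd) /= [] /val_inj.
by rewrite [s r]surjective_pairing cE bE -surjective_pairing.
Qed.

Lemma weight_block_digits s q :
  (\sum_(0 <= i < k * q) (block_digits s i).1 = checkpoint q)%N.
Proof.
elim: q => [|q IH].
  by rewrite muln0 big_geq // /checkpoint muln0 mulr0 truncn0.
have first_bound : (k * q <= k * q.+1)%N by rewrite leq_mul2l leqnSn.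
rewrite (sum_nat_split _ first_bound) IH mulnS addnK.
have -> : (\sum_(i < k) (block_digits s (k * q + i)).1 =
  \sum_(j < k) ((tnth (val (s q).1) j).+1 +
    if j == ord_max then checkpoint q.+1 - (k + n + checkpoint q) else 0))%N.
  by apply: eq_bigr => j _; rewrite block_digitsE.
rewrite big_split /= -big_mkcond big_pred1_eq.
have -> : (\sum_(j < k) (tnth (val (s q).1) j).+1 = k + n)%N.
  have := valP (s q).1; rewrite inE big_tuple => /eqP sn.
  under eq_bigr do rewrite -addn1.
  by rewrite big_split /= sn sum_nat_const card_ord muln1 addnC.
by have := checkpointS q; lia.
Qed.

(** The weight and [t i] are monotone in [i] and agree up to 1 at the block ends; in
    between they drift apart by at most the share [t k] of one block. *)
Lemma checkpoint_dist s i :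
  `|(\sum_(0 <= l < i) (block_digits s l).1)%N%:R - t * i%:R| <= t * k%:R + 1.
Proof.
pose S j := (\sum_(0 <= l < j) (block_digits s l).1)%N.
have S_le a b : (a <= b)%N -> (S a <= S b)%N.
  by move=> ab; rewrite /S (sum_nat_split _ ab) leq_addr.
set q := (i %/ k)%N.
have ql : (k * q <= i)%N by rewrite mulnC leq_trunc_div.
have qu : (i <= k * q.+1)%N by rewrite mulnC ltnW // ltn_ceil.
have := S_le _ _ ql; have := S_le _ _ qu; rewrite /S !weight_block_digits -/(S i).
rewrite -!(ler_nat R) => Su Sl.
have /andP[_ cl] := checkpointP q; have /andP[cu _] := checkpointP q.+1.
have iu : t * (k * q.+1)%:R <= t * (i%:R + k%:R).
  by rewrite ler_pM2l // -natrD ler_nat mulnS addnC leq_add2r.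
have il : t * i%:R <= t * ((k * q)%:R + k%:R).
  by rewrite ler_pM2l // -natrD ler_nat -mulnSr.
rewrite ler_norml; apply/andP; split; lra.
Qed.

Lemma weight_digit_word x (d : nat -> nat * nat) i :
  (forall l, digit (iter l T x) = d l) ->
  weight (digit_word x i) = (\sum_(0 <= l < i) (d l).1)%N.
Proof.
move=> xd; rewrite /weight /digit_word big_map /index_iota subn0.
by apply: eq_bigr => l _; rewrite xd.
Qed.

(** The weights of the coded points are prescribed exactly at the block ends, so
    [close_digit_word] separates them at scale [p^-(checkpoint q)], and
    [checkpoint_dist] puts them in the level set.  With [N] the number of blocks, the
    hypothesis says that [N^-q] is at most the power [s] of this scale. *)
Lemma level_measure_neq0 s : 0 <= s ->
  s * (t * ln p%:R) * k%:R <= ln (#|{: block}|%:R) -> (1 < #|{: block}|)%N ->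
  hausdorff_measure s (lyapunov_level p_pr (t * ln p%:R)) != 0%E.
Proof.
move=> s0 entropy_le card1.
have /choice[x xP] : forall u, exists y : Qp, infinite_expansion y /\
    forall l, digit (iter l T y) = block_digits u l.
  move=> u.
  by have [y yi yd] := exists_digits R p_pr (block_digits_valid u); exists y.
have wordP u q : weight (digit_word (x u) (k * q)) = checkpoint q.
  by rewrite (weight_digit_word _ (xP u).2) weight_block_digits.
apply: (@coded_set_measure_neq0 R Qp block x
  (fun q => p%:R ^- checkpoint q)) => //.
- by move=> q; rewrite invr_gt0 exprn_gt0.
- move=> u v q; rewrite padic_mdistE -(wordP u) => uv; apply: block_digits_inj.
  have E := close_digit_word (xP u).1 (xP v).1 uv.
  move=> i ik; rewrite -(xP u).2 -(xP v).2.
  have := congr1 (nth (0%N, 0%N) ^~ i) E; rewrite /digit_word.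
  by rewrite !(nth_map 0%N) ?size_iota // !nth_iota.
- move=> q; have N0 : 0 < #|{: block}|%:R :> R by rewrite ltr0n ltnW.
  rewrite /powR gt_eqF ?invr_gt0 ?exprn_gt0 // lnV ?posrE ?exprn_gt0 // lnXn //.
  rewrite -[leLHS]lnK ?posrE ?invr_gt0 ?exprn_gt0 //.
  rewrite lnV ?posrE ?exprn_gt0 // lnXn // ler_expR mulrN lerN2.
  rewrite -!(mulr_natl (ln _)).
  apply: le_trans (ler_wpM2l (ler0n _ q) entropy_le).
  have -> : q%:R * (s * (t * ln p%:R) * k%:R) = s * (t * (k * q)%:R * ln p%:R).
    by rewrite natrM; ring.
  rewrite ler_wpM2l // ler_wpM2r //; first by rewrite ln_ge0 // ltW.
  by case/andP: (checkpointP q).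
move=> u; apply/lyapunov_levelP; split; first by case: (xP u).
rewrite mulfK; last by rewrite gt_eqF // ln_gt0.
apply/cvgrPdist_le => e e0.
have B0 : 0 < t * k%:R + 1 by rewrite addr_gt0 // mulr_gt0.
exists (Num.truncn ((t * k%:R + 1) / e)).+1 => // i /= iN.
have i0 : 0 < i%:R :> R by rewrite ltr0n (leq_trans _ iN).
rewrite (weight_digit_word _ (xP u).2) distrC.
set S := (\sum_(_ <= _ < _) _)%N.
have -> : S%:R / i%:R - t = (S%:R - t * i%:R) / i%:R by field; rewrite gt_eqF.
rewrite normf_div (gtr0_norm i0) ler_pdivrMr //.
apply: le_trans (checkpoint_dist u i) _.
rewrite -ler_pdivrMl // [leLHS]mulrC ltW // (lt_le_trans (truncnS_gt _)) //.
by rewrite ler_nat.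
Qed.

End LowerBound.

(** * The spectrum *)

(** Bounding [- ln y = ln (1/y)] linearly with slope [e/2], multiplication by [y]
    leaves [e/2] plus a multiple of [y]. *)
Lemma xlnx_small (R : realType) (e : R) : 0 < e ->
  exists2 d, 0 < d & forall y, 0 < y -> y < d -> `|y * ln y| <= e.
Proof.
move=> e0; have d0 : 0 < e / 2 by rewrite divr_gt0.
pose B := `|ln (e / 2)| + 1; have B0 : 0 < B by rewrite ltr_wpDl.
exists (Num.min 1 (e / 2 / B)); first by rewrite lt_min ltr01 divr_gt0.
move=> y y0; rewrite lt_min => /andP[y1 yB].
rewrite ler0_norm; last by rewrite mulr_ge0_le0 ?ln_le0 // ltW.
have yV0 : 0 < y^-1 by rewrite invr_gt0.
have lny : - ln y <= e / 2 * y^-1 - ln (e / 2).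
  by rewrite -lnV ?posrE //; apply: ln_le_linear.
have : y * - ln y <= y * (e / 2 * y^-1 - ln (e / 2)) by rewrite ler_pM2l.
have -> : y * (e / 2 * y^-1 - ln (e / 2)) = e / 2 + y * - ln (e / 2).
  by field; rewrite gt_eqF.
have : y * - ln (e / 2) <= e / 2.
  apply: (@le_trans _ _ (y * B)); last by rewrite -ler_pdivlMr // ltW.
  by rewrite ler_pM2l // (le_trans (ler_norm _)) // normrN lerDl.
lra.
Qed.

Lemma spectrum_entropy (R : realType) (p : nat) (alpha : R) : (1 < p)%N ->
  ln p%:R < alpha ->
  lyapunov_spectrum p alpha =
  (ln (p%:R - 1) + entropy (alpha / ln p%:R)) / alpha.
Proof.
move=> p1 pa; have L0 : 0 < ln p%:R :> R by rewrite ln_gt0 // ltr1n.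
have a0 : 0 < alpha by apply: lt_trans pa.
rewrite /lyapunov_spectrum /entropy /log_base; congr (_ / _).
have -> : alpha / ln p%:R - 1 = (alpha - ln p%:R) / ln p%:R.
  by field; rewrite gt_eqF.
rewrite !ln_div ?posrE ?subr_gt0 //; field; rewrite gt_eqF //.
Qed.

(** The two singular terms combine into [- (a - L) ln (a - L) / L], with
    [L = ln p], which tends to 0. *)
Lemma lyapunov_spectrum_cvg (R : realType) (p : nat) : (1 < p)%N ->
  lyapunov_spectrum p alpha @[alpha --> (ln p%:R : R)^'+]
     --> (ln (p%:R - 1) / ln p%:R : R).
Proof.
move=> p1; set L := ln p%:R; have L0 : 0 < L by rewrite ln_gt0 // ltr1n.
have id_cvg : a @[a --> L^'+] --> L by apply: cvg_at_right_filter; exact: cvg_id.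
have ylny : (a - L) * ln (a - L) @[a --> L^'+] --> (0 : R).
  apply/cvgrPdist_le => e e0; have [d d0 dP] := xlnx_small e0.
  near=> a; rewrite sub0r normrN; apply: dP.
    by rewrite subr_gt0; near: a; exact: nbhs_right_gt.
  by rewrite ltrBlDl; near: a; apply: nbhs_right_lt; rewrite ltrDl.
have lnL : ln a @[a --> L^'+] --> ln L.
  exact: (cvg_comp _ _ id_cvg (continuous_ln L0)).
have -> : ln (p%:R - 1) / L =
    (ln (p%:R - 1) - ln L + L * ln L / L - 0 / L) / L.
  by rewrite mul0r subr0 mulrAC mulfV ?mul1r ?subrK // gt_eqF.
have inv_cvg : a^-1 @[a --> L^'+] --> L^-1.
  by apply: cvgV => //; rewrite gt_eqF.
have main : (ln (p%:R - 1) - ln L + a * ln a / L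
    - (a - L) * ln (a - L) / L) / a @[a --> L^'+] -->
    (ln (p%:R - 1) - ln L + L * ln L / L - 0 / L) / L.
  apply: cvgM inv_cvg; apply: cvgB; last by apply: cvgM ylny _; exact: cvg_cst.
  apply: cvgD; first exact: cvg_cst.
  by apply: cvgM; [exact: cvgM | exact: cvg_cst].
apply: cvg_trans main.
apply: near_eq_cvg; near=> a.
rewrite /lyapunov_spectrum /log_base -/L /=; congr (_ / _).
by field; rewrite gt_eqF.
Unshelve. all: by end_near. Qed.

(** For the lower bound, a dimension [s] below the expected one leaves a gap [g], half
    of which absorbs the error in [composition_entropy]; the other half makes the
    number of blocks larger than 1. *)
Lemma hausdorff_dim_level (R : realType) (p : nat) (p_pr : prime p) (alpha : R) :
  ln p%:R <= alpha ->
  hausdorff_dim (lyapunov_level p_pr alpha) =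
  ((ln (p%:R - 1) + entropy (alpha / ln p%:R)) / alpha)%:E.
Proof.
move=> alpha1; have p1 := prime_gt1 p_pr.
have L0 : 0 < ln p%:R :> R by rewrite ln_gt0 // ltr1n.
have a0 : 0 < alpha by apply: lt_le_trans alpha1.
set t := alpha / ln p%:R.
have t1 : 1 <= t by rewrite ler_pdivlMr // mul1r.
have tL : t * ln p%:R = alpha by rewrite divfK // gt_eqF.
have pE : p%:R - 1 = p.-1%:R :> R by rewrite -subn1 natrB // ltnW.
have pge1 : 1 <= p%:R - 1 :> R by rewrite pE ler1n -ltnS prednK // ltnW.
have K0 : 0 <= ln (p%:R - 1) :> R by rewrite ln_ge0.
set D := (_ + _) / _.
have D0 : 0 <= D.
  by apply: divr_ge0; [rewrite addr_ge0 // entropy_ge0 | exact: ltW].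
apply/eqP; rewrite eq_le; apply/andP; split.
  apply: hausdorff_dim_le => // s Ds; apply: level_measure_eq0 => //.
    by apply: le_trans D0 _; exact: ltW.
  by rewrite -ltr_pdivrMr.
apply: le_hausdorff_dim => s s0 sD; rewrite -tL.
pose g := ln (p%:R - 1) + entropy t - s * alpha.
have g0 : 0 < g by rewrite subr_gt0 -ltr_pdivlMr.
have [|m Hm] := composition_entropy t1 (e := g / 2); first by rewrite divr_gt0.
have lnN : ln #|{: block p t m}|%:R =
    ln 'C(m + excess t m, m)%:R + m.+1%:R * ln (p%:R - 1) :> R.
  rewrite card_block natrM natrX -pE lnM ?posrE ?ltr0n ?bin_gt0 ?leq_addr //.
    by rewrite lnXn ?mulr_natl // (lt_le_trans _ pge1).
  by rewrite exprn_gt0 // (lt_le_trans _ pge1).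
have k0 : 0 < m.+1%:R :> R by rewrite ltr0n.
have kg : 0 < m.+1%:R * g by rewrite mulr_gt0.
have lt_N : s * (t * ln p%:R) * m.+1%:R < ln #|{: block p t m}|%:R.
  by rewrite lnN tL; move: Hm kg; rewrite /g; lra.
apply: (level_measure_neq0 p_pr t1 s0 (ltW lt_N)).
rewrite -(ltr_nat R) ltNge; apply/negP => /ln_le0; apply/negP; rewrite -ltNge.
by apply: le_lt_trans lt_N; rewrite tL !mulr_ge0 // ltW.
Qed.

Theorem theorem1p2 (R : realType) (p : nat) (p_pr : prime p) :
  (lyapunov_spectrum p alpha @[alpha --> (ln p%:R : R)^'+]
     --> (ln (p%:R - 1) / ln p%:R : R)) /\
  (forall alpha : R, ln p%:R <= alpha ->
     hausdorff_dim (lyapunov_level p_pr alpha) =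
     (if alpha == ln p%:R then ln (p%:R - 1) / ln p%:R
      else lyapunov_spectrum p alpha)%:E).
Proof.
have p1 := prime_gt1 p_pr; split; first exact: lyapunov_spectrum_cvg.
move=> alpha pa; rewrite hausdorff_dim_level //; case: eqVneq => [->|npa].
  by rewrite divff ?entropy1 ?addr0 // gt_eqF // ln_gt0 // ltr1n.
by rewrite spectrum_entropy // lt_neqAle eq_sym npa.
Qed.
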